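(* Let $f:\mathbb{R}\to\mathbb{R}_+\cup\{\infty\}$ be a nonnegative, proper, closed, convex and essentially smooth function, and suppose there is a finite set $W\subset \mathrm{int}(\mathrm{dom}\,f)$ such that $f$ is strongly convex on every compact convex subset of $\mathrm{int}(\mathrm{dom}\,f)\setminus W$ and $f'$ is locally Lipschitz continuous on every convex subset of $\mathrm{int}(\mathrm{dom}\,f)\setminus W$. Let $\mathcal{K}=\mathrm{epi}\,f^\pi\subset\mathbb{R}^3$. Let $\Upsilon$ be the set of all $\mathbf{z}\in\mathbb{R}^3$ such that, with $\mathcal{L}:=\{\mathbf{z}\}^\perp$, the feasibility problem ''find a point in $\mathcal{L}\cap\mathcal{K}$'' is nontrivially weakly feasible. Then, for any $s>1$, for $\mathcal{H}^s$-almost every $\mathbf{z}\in\Upsilon$, the pair $\{\mathcal{K},\{\mathbf{z}\}^\perp\}$ satisfies a uniform H\''olderian error bound with exponent $1/2$.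
   Context: $\mathbb{R}^3$ carries the standard inner product. A proper convex $f:\mathbb{R}\to\mathbb{R}\cup\{\infty\}$ is essentially smooth if $\mathrm{int}(\mathrm{dom}\,f)\neq\emptyset$, $f$ is differentiable on $\mathrm{int}(\mathrm{dom}\,f)$, and $|f'(x^k)|\to\infty$ whenever $\{x^k\}\subset\mathrm{int}(\mathrm{dom}\,f)$ converges to a point of $\mathrm{bdry}(\mathrm{dom}\,f)$. ''Closed'' means lower semicontinuous. Recession function: $f_\infty(d)=\lim_{t\to\infty}\frac{f(y+td)-f(y)}{t}$ for any fixed $y\in\mathrm{dom}\,f$. Closed perspective: $f^\pi(x,t)=t f(x/t)$ if $t>0$, $f_\infty(x)$ if $t=0$, $\infty$ if $t<0$. $\mathrm{epi}\,f^\pi=\{(x,t,r)\in\mathbb{R}^3: r\ge f^\pi(x,t)\}$, a closed convex cone. For an affine subspace $\mathcal{A}\subseteq\mathbb{R}^3$, the problem ''find a point in $\mathcal{A}\cap\mathcal{K}$'' is nontrivially weakly feasible if $\mathcal{A}\cap\mathcal{K}\neq\emptyset$, $\mathcal{A}\cap\mathrm{int}(\mathcal{K})=\emptyset$ and $\mathcal{A}\cap\mathcal{K}\neq\{\mathbf{0}\}$. Closed convex sets $C_1,C_2$ with $C_1\cap C_2\ne\emptyset$ satisfy a uniform H\''olderian error bound with exponent $\gamma\in(0,1]$ if for every bounded set $B$ there is $\kappa_B>0$ with $\mathrm{d}(\mathbf{x},C_1\cap C_2)\le\kappa_B\max\{\mathrm{d}(\mathbf{x},C_1),\mathrm{d}(\mathbf{x},C_2)\}^\gamma$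 for all $\mathbf{x}\in B$. $\mathcal{H}^s$ is the $s$-dimensional Hausdorff measure: $\mathcal{H}^s(A)=\sup_{\delta>0}\inf\{\sum_{j\ge1}\mathrm{diam}(C_j)^s: A\subseteq\bigcup_j C_j,\ \mathrm{diam}(C_j)\le\delta\}$; ''$\mathcal{H}^s$-almost every'' means outside a set of $\mathcal{H}^s$-measure zero. *)

(* Defs.v *)
From HB Require Import structures.
From mathcomp Require Import all_boot all_order all_algebra.
From mathcomp Require Import all_classical all_reals all_analysis.
Set Implicit Arguments.
Unset Strict Implicit.
Unset Printing Implicit Defensive.
Import Order.TTheory GRing.Theory Num.Theory.
Import numFieldNormedType.Exports.

Local Open Scope classical_set_scope.
Local Open Scope ring_scope.

Section Euclidean.
Variables (R : realType) (n : nat).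
Implicit Types (x y z : 'rV[R]_n) (A B K : set 'rV[R]_n).

Definition dotv x y : R := \sum_i x 0 i * y 0 i.

(* The norm [`| x |] of the library on matrices is the sup norm; distances and
   diameters below use the Euclidean norm.  Both induce the same topology and
   the same bounded sets. *)
Definition enorm x : R := Num.sqrt (dotv x x).

Definition orthv z : set 'rV[R]_n := [set x | dotv z x = 0].

Definition edistance x A : R := inf [set enorm (x - a) | a in A].

Definition nontrivially_weakly_feasible A K : Prop :=
  [/\ A `&` K !=set0, A `&` K° = set0 & A `&` K <> [set 0]].

Definition uniform_holder_error_bound A B (gamma : R) : Prop :=
  [/\ A `&` B !=set0, 0 < gamma <= 1 &
    forall S : set 'rV[R]_n, bounded_set S -> exists2 kappa : R, 0 < kappa &
      forall x, S x ->
        edistance x (A `&` B) <=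
          kappa * Num.max (edistance x A) (edistance x B) `^ gamma].

(* The maximum with 0 only matters for the empty set, of diameter 0. *)
Definition ediam A : \bar R :=
  maxe 0%E (ereal_sup [set (enorm (p.1 - p.2))%:E | p in A `*` A]).

Definition hausdorff_measure (s : R) A : \bar R :=
  ereal_sup [set ereal_inf [set (\sum_(0 <= j <oo) ediam (C j) `^ s)%E
      | C in [set C : nat -> set 'rV[R]_n |
               A `<=` \bigcup_j C j /\ forall j, (ediam (C j) <= delta%:E)%E]]
    | delta in [set delta : R | 0 < delta]].

Definition hausdorff_ae_in (s : R) A (P : 'rV[R]_n -> Prop) : Prop :=
  exists2 N, hausdorff_measure s N = 0%E &
    forall x, A x -> ~ N x -> P x.

End Euclidean.

Section ConvexFunctions.
Variable R : realType.
Implicit Types (f : R -> \bar R) (C : set R).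

Definition dom f : set R := [set x | (f x < +oo)%E].

Definition proper_efun f : Prop := (forall x, (-oo < f x)%E) /\ dom f !=set0.

Definition econvex f : Prop :=
  forall x y t : R, 0 <= t <= 1 ->
    (f (t * x + (1 - t) * y)%R <= t%:E * f x + (1 - t)%:E * f y)%E.

(* [fine \o f] agrees with [f] on [dom f] when [f] is proper; derivatives are
   only taken at interior points of [dom f]. *)
Definition fderiv f : R -> R := derive1 (fine \o f).

Definition essentially_smooth f : Prop :=
  [/\ (dom f)° !=set0,
      forall x, (dom f)° x -> derivable (fine \o f) x 1 &
      forall (u : nat -> R) (a : R), (forall k, (dom f)° (u k)) ->
        (closure (dom f) `\` (dom f)°) a ->
        u @ \oo --> a -> (fun k => `|fderiv f (u k)|) @ \oo --> +oo].

Definition strongly_convex_on f C : Prop :=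
  exists2 mu : R, 0 < mu & forall x y t : R, C x -> C y -> 0 <= t <= 1 ->
    (f (t * x + (1 - t) * y)%R <= t%:E * f x + (1 - t)%:E * f y
       - (mu / 2 * (t * (1 - t)) * (x - y) ^+ 2)%:E)%E.

(* The limit does not depend on the base point in [dom f]; [get] picks one. *)
Definition recession f (d : R) : \bar R :=
  let y := get (dom f) in
  lim (((f (y + t * d)%R - f y) * (t^-1)%:E)%E @[t --> +oo%R]).

Definition closed_perspective f (x t : R) : \bar R :=
  if 0 < t then (t%:E * f (x / t)%R)%E
  else if t == 0 then recession f x
  else +oo%E.

Definition epi_perspective f : set 'rV[R]_3 :=
  [set v : 'rV[R]_3 |
    (closed_perspective f (v 0 0)%R (v 0 1)%R <= (v 0 2)%R%:E)%E].

End ConvexFunctions.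

(* Main.v *)
(* Write E for the epigraph of f. A normal z whose hyperplane meets K
   nontrivially but misses its interior lies, up to sign, in the dual cone of K.
   If the last coordinate of z vanishes, the exposed face is the vertical ray,
   and the functional z grows linearly away from it unless it vanishes at an end
   of dom f: three exceptional rays of normals. Otherwise z is proportional to
   (-y, w, 1) with a - y u + w >= 0 on E. If the hyperplane contains a recession
   direction d = 1 or -1, then y is the corresponding asymptotic slope of f; for
   w strictly above the conjugate of f at y the error bound is Lipschitz, since
   f is not affine, and one exceptional w remains for each d. In the last case y
   is a subgradient at some x, which is interior by essential smoothness, so that
   y = f'(x) and w is determined by x; either x lies in the finite set W, or
   strong convexity near x gives quadratic growth, hence the exponent 1/2. All
   exceptional normals lie on finitely many rays, a null set for s > 1. *)
Require Import Defs.
From HB Require Import structures.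
From mathcomp Require Import all_boot all_order all_algebra.
From mathcomp Require Import all_classical all_reals all_analysis.
From mathcomp Require Import ring lra.
Import Order.TTheory GRing.Theory Num.Theory.
Import numFieldNormedType.Exports.

Local Open Scope classical_set_scope.
Local Open Scope ring_scope.
Set Implicit Arguments.
Unset Strict Implicit.
Unset Printing Implicit Defensive.

(** * Hausdorff measure of finitely many rays *)

Lemma powR_telescope (R : realType) (s a : R) : 1 < s -> 0 < a ->
  (s - 1) * (a + 1)^-1 `^ s <= a `^ (1 - s) - (a + 1) `^ (1 - s).
Proof.
move=> s1 a0.
have a10 : 0 < a + 1 by lra.
have ln_ge : (a + 1)^-1 <= ln (a + 1) - ln a.
  have : ln (a / (a + 1)) <= - (a + 1)^-1.
    rewrite -[leRHS]expRK ler_ln ?posrE ?expR_gt0 ?divr_gt0//.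
    apply: le_trans (expR_ge1Dx _).
    by rewrite le_eqVlt; apply/orP; left; apply/eqP; field; lra.
  by rewrite ln_div ?posrE//; lra.
have powE x : 0 < x -> x `^ (1 - s) = expR ((1 - s) * ln x).
  by move=> x0; rewrite /powR gt_eqF.
have -> : (a + 1)^-1 `^ s = (a + 1) `^ (1 - s) * (a + 1)^-1.
  rewrite -powR_inv1 ?(ltW a10)// -powRrM -powRD ?(lt0r_neq0 a10) ?implybT//.
  by congr (_ `^ _); ring.
have -> : a `^ (1 - s) =
    (a + 1) `^ (1 - s) * expR ((s - 1) * (ln (a + 1) - ln a)).
  by rewrite !powE// -expRD; congr (expR _); ring.
have p0 : 0 < (a + 1) `^ (1 - s) by exact: powR_gt0.
have : 1 + (s - 1) / (a + 1) <= expR ((s - 1) * (ln (a + 1) - ln a)).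
  apply: le_trans (expR_ge1Dx _); rewrite lerD2l ler_pM2l//; lra.
move=> /(ler_wpM2l (ltW p0)); lra.
Qed.

Lemma sum_powR_le (R : realType) (s : R) n : 1 < s ->
  \sum_(0 <= j < n) (j.+1%:R^-1 `^ s) <= 1 + (s - 1)^-1.
Proof.
move=> s1; have s10 : 0 < (s - 1)^-1 by rewrite invr_gt0; lra.
suff H k : \sum_(0 <= j < k.+1) (j.+1%:R^-1 `^ s) + (s - 1)^-1 * k.+1%:R `^ (1 - s)
    <= 1 + (s - 1)^-1.
  case: n => [|n]; first by rewrite big_geq//; lra.
  apply: le_trans (H n); rewrite lerDl mulr_ge0 ?powR_ge0//; lra.
elim: k => [|k ih]; first by rewrite big_nat1 invr1 powR1; lra.
rewrite big_nat_recr//=; apply: le_trans ih.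
rewrite -addrA lerD2l.
have := @powR_telescope _ s k.+1%:R s1 (ltr0Sn _ _); rewrite natr1 => h.
have : k.+2%:R^-1 `^ s <= (s - 1)^-1 * (k.+1%:R `^ (1 - s) - k.+2%:R `^ (1 - s)).
  by rewrite mulrC ler_pdivlMr; lra.
lra.
Qed.

Section EuclideanNorm.
Variables (R : realType) (n : nat).
Implicit Types x y z : 'rV[R]_n.

Lemma dotvv_ge0 x : 0 <= dotv x x.
Proof. by apply: sumr_ge0 => i _; rewrite -expr2 sqr_ge0. Qed.

Lemma enorm_ge0 x : 0 <= enorm x. Proof. exact: sqrtr_ge0. Qed.

Lemma enormZ c x : enorm (c *: x) = `|c| * enorm x.
Proof.
rewrite /enorm -sqrtr_sqr -sqrtrM ?sqr_ge0//; congr Num.sqrt.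
by rewrite /dotv mulr_sumr; apply: eq_bigr => i _; rewrite !mxE; ring.
Qed.

End EuclideanNorm.

Definition rays (R : realType) n (v : seq 'rV[R]_n) : set 'rV[R]_n :=
  [set x | exists2 d, d \in v & exists2 c, 0 <= c & x = c *: d].

Lemma harmonic_block (R : realType) (h c : R) : 0 < h -> 0 <= c ->
  exists k, h * series harmonic k <= c <= h * series harmonic k.+1.
Proof.
move=> h0 c0.
have [n cn] : exists n, c <= h * series harmonic n.
  apply: contrapT => /forallNP nc; apply: (@dvg_harmonic R).
  apply: nondecreasing_is_cvgn.
    by apply/nondecreasing_series => i _ _; exact: harmonic_ge0.
  exists (c / h) => _ [n _ <-]; rewrite ler_pdivlMr// mulrC.
  by apply: ltW; rewrite ltNge; apply/negP; exact: nc.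
have ex : exists n, c <= h * series harmonic n by exists n.
case: (ex_minnP ex) => -[|m] cm minm.
  exists 0%N; move: cm; rewrite /series/= big_geq// mulr0 => cm.
  by rewrite c0 (le_trans cm)// mulr_ge0 ?(ltW h0)// big_nat1 harmonic_ge0.
exists m; rewrite cm andbT leNgt; apply/negP => /ltW/minm.
by rewrite ltnn.
Qed.

Lemma ediam_le (R : realType) n (A : set 'rV[R]_n) (r : R) : 0 <= r ->
  (forall x y, A x -> A y -> enorm (x - y) <= r) -> (ediam A <= r%:E)%E.
Proof.
move=> r0 Ar; rewrite /ediam ge_max lee_fin r0/=.
by apply: ge_ereal_sup => _ [[x y] [/= Ax Ay] <-]; rewrite lee_fin Ar.
Qed.

Lemma ediam_ge0 (R : realType) n (A : set 'rV[R]_n) : (0 <= ediam A)%E.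
Proof. by rewrite /ediam le_max lexx. Qed.

(* Each ray is cut into pieces of lengths proportional to 1, 1/2, 1/3, ...:
   these cover it, while the [s]-th powers of the lengths are summable. *)
Lemma hausdorff_measure_rays (R : realType) n (v : seq 'rV[R]_n) (s : R) :
  1 < s -> hausdorff_measure s (rays v) = 0%E.
Proof.
move=> s1; have s0 : 0 < s by lra.
apply/eqP; rewrite eq_le; apply/andP; split; last first.
  apply: le_trans (ereal_sup_ubound _); last by exists 1 => /=; [exact: ltr01|].
  apply: le_ereal_inf_tmp => _ [C _ <-].
  by apply: nneseries_ge0 => j _ _; exact: poweR_ge0.
apply: ge_ereal_sup => _ [dl /= dl0 <-].
apply/lee_addgt0Pr => e e0; rewrite add0e.
pose T := 1 + (s - 1)^-1.
have T0 : 0 < T by rewrite addr_gt0// invr_gt0; lra.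
pose A := Num.min dl ((e / T) `^ s^-1).
have A0 : 0 < A by rewrite lt_min dl0/= powR_gt0// divr_gt0.
have AsT : A `^ s * T <= e.
  rewrite -ler_pdivlMr//.
  rewrite -[leRHS]powRr1; last by rewrite ltW// divr_gt0.
  rewrite -[in leRHS](mulVf (lt0r_neq0 s0)) powRrM.
  apply: ge0_ler_powR; rewrite ?nnegrE ?powR_ge0 ?(ltW s0) ?(ltW A0)//.
  by rewrite ge_min lexx orbT.
pose M := (size v).+1.
pose D := 1 + \sum_(d <- v) enorm d.
have D0 : 0 < D by rewrite ltr_wpDr// sumr_ge0// => i _; exact: enorm_ge0.
have dD d : d \in v -> enorm d <= D.
  move=> dv; rewrite /D (big_rem d)//= ler_wpDl// lerDl.
  by rewrite sumr_ge0// => i _; exact: enorm_ge0.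
pose h := A / (M%:R * D).
have M0 : 0 < M%:R :> R by rewrite ltr0n.
have h0 : 0 < h by rewrite divr_gt0// mulr_gt0.
pose C j : set 'rV[R]_n := [set x | exists2 c,
  h * series harmonic (j %/ M)%N <= c <= h * series harmonic (j %/ M).+1
  & x = c *: nth 0 v (j %% M)%N].
have diamC j : (ediam (C j) <= (A * j.+1%:R^-1)%:E)%E.
  apply: ediam_le => [|_ _ [c /andP[c1 c2] ->] [c' /andP[c1' c2'] ->]].
    by rewrite mulr_ge0 ?invr_ge0 ?ler0n ?(ltW A0).
  rewrite -scalerBl enormZ.
  have nD : enorm (nth 0 v (j %% M)%N) <= D.
    have [jv|jv] := ltnP (j %% M)%N (size v); first by rewrite dD// mem_nth.
    rewrite nth_default// -(scale0r 0) enormZ normr0 mul0r; exact: ltW.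
  have cc : `|c - c'| <= h * harmonic (j %/ M)%N.
    have : h * series harmonic (j %/ M).+1 - h * series harmonic (j %/ M)%N =
      h * harmonic (j %/ M)%N.
      by rewrite /series/= big_nat_recr//=; ring.
    by move=> <-; rewrite ler_norml; apply/andP; split; lra.
  apply: le_trans (ler_pM _ _ cc nD) _; rewrite ?enorm_ge0//.
  rewrite -[leLHS]mulrA [harmonic _ * D]mulrC mulrA /h.
  have -> : A / (M%:R * D) * D = A / M%:R by field; rewrite !lt0r_neq0.
  rewrite -mulrA ler_pM2l// /harmonic/= -invfM lef_pV2 ?posrE ?mulr_gt0 ?ltr0n//.
  by rewrite -natrM ler_nat mulnC; exact: ltn_ceil.
apply: ge_ereal_inf; exists (\sum_(0 <= j <oo) ediam (C j) `^ s)%E.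
  exists C => //; split.
    move=> _ [d dv [c c0 ->]].
    have [k kc] := harmonic_block h0 c0.
    have iv : (index d v < M)%N by rewrite ltnS index_size.
    exists (k * M + index d v)%N => //.
    exists c; first by rewrite divnMDl// divn_small// addn0.
    by rewrite modnMDl modn_small// nth_index.
  move=> j; apply: le_trans (diamC j) _; rewrite lee_fin.
  have Adl : A <= dl by rewrite ge_min lexx.
  apply: le_trans Adl; rewrite ler_piMr ?(ltW A0)// invf_le1 ?ler1n ?ltr0n//.
apply: lime_le; first by apply: is_cvg_nneseries => j _ _; exact: poweR_ge0.
apply: nearW => k.
apply: le_trans
  (_ : (\sum_(0 <= j < k) (A `^ s * (j.+1%:R^-1 `^ s))%:E <= _)%E).
  apply: lee_sum => j _.
  rewrite -powRM ?invr_ge0 ?ler0n ?(ltW A0)// -poweR_EFin.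
  apply: gt0_ler_poweR; rewrite ?(ltW s0) ?in_itv/= ?ediam_ge0 ?leey//.
  by rewrite lee_fin mulr_ge0 ?invr_ge0 ?ler0n ?(ltW A0).
rewrite sumEFin lee_fin -mulr_sumr; apply: le_trans AsT.
by rewrite ler_pM2l ?powR_gt0// sum_powR_le.
Qed.

(** * Euclidean distances *)

Section EuclideanDistance.
Variables (R : realType) (n : nat).
Implicit Types (x y z p q : 'rV[R]_n) (A K : set 'rV[R]_n).

Lemma dotvD z x y : dotv z (x + y) = dotv z x + dotv z y.
Proof.
by rewrite /dotv -big_split/=; apply: eq_bigr => i _; rewrite !mxE mulrDr.
Qed.

Lemma dotvZ z c x : dotv z (c *: x) = c * dotv z x.
Proof.
by rewrite /dotv mulr_sumr; apply: eq_bigr => i _; rewrite !mxE mulrCA.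
Qed.

Lemma dotvB z x y : dotv z (x - y) = dotv z x - dotv z y.
Proof. by rewrite dotvD -scaleN1r dotvZ mulN1r. Qed.

Lemma dotZv c z x : dotv (c *: z) x = c * dotv z x.
Proof.
by rewrite /dotv mulr_sumr; apply: eq_bigr => i _; rewrite !mxE mulrA.
Qed.

Lemma orthvZ c z : c != 0 -> orthv (c *: z) = orthv z.
Proof.
move=> c0; apply/seteqP; split => x; rewrite /orthv/= dotZv => /eqP.
  by rewrite mulf_eq0 (negPf c0) => /eqP.
by move=> /eqP ->; rewrite mulr0.
Qed.

Lemma coord_le_enorm x i : `|x 0 i| <= enorm x.
Proof.
rewrite -sqrtr_sqr ler_wsqrtr// /dotv (bigD1 i)//= expr2 lerDl.
by apply: sumr_ge0 => j _; rewrite -expr2 sqr_ge0.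
Qed.

Lemma coord_le_norm x i : `|x 0 i| <= `|x|.
Proof.
by rewrite [leRHS]mx_normrE (le_bigmax _ (fun ij => `|x ij.1 ij.2|) (0, i)).
Qed.

Lemma enorm_sqr x : enorm x ^+ 2 = dotv x x.
Proof. by rewrite sqr_sqrtr// dotvv_ge0. Qed.

Lemma enorm_le_coord x (r : R) : (forall i, `|x 0 i| <= r) -> 0 <= r ->
  enorm x <= n%:R * r.
Proof.
move=> xr r0; rewrite -[leRHS]ger0_norm ?mulr_ge0// -sqrtr_sqr ler_wsqrtr//.
have xr2 i : x 0 i * x 0 i <= r ^+ 2.
  by rewrite -expr2 -real_normK ?num_real// lerXn2r ?nnegrE.
apply: le_trans (ler_sum _ (fun i _ => xr2 i)) _.
rewrite sumr_const card_ord exprMn -[leLHS]mulr_natl ler_wpM2r ?sqr_ge0//.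
by rewrite -natrX ler_nat; case: (n) => // k; rewrite -mulnn leq_pmull.
Qed.

Lemma dotv_le_enorm z x : `|dotv z x| <= (\sum_i `|z 0 i|) * enorm x.
Proof.
apply: le_trans (ler_norm_sum _ _ _) _; rewrite mulr_suml ler_sum// => i _.
by rewrite normrM ler_wpM2l// coord_le_enorm.
Qed.

Lemma enormD_sqr x y : enorm (x + y) ^+ 2 <= 2 * (enorm x ^+ 2 + enorm y ^+ 2).
Proof.
rewrite !enorm_sqr /dotv -big_split mulr_sumr ler_sum//= => i _.
rewrite !mxE; have := sqr_ge0 (x 0 i - y 0 i); lra.
Qed.

Let has_inf_edistance x A : A !=set0 -> has_inf [set enorm (x - a) | a in A].
Proof.
case=> a Aa; split; first by exists (enorm (x - a)), a.
by exists 0 => _ [b _ <-]; exact: enorm_ge0.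
Qed.

Lemma edistance_ge0 x A : A !=set0 -> 0 <= edistance x A.
Proof.
move=> A0; apply: lb_le_inf; first by case: (has_inf_edistance x A0).
by move=> _ [b _ <-]; exact: enorm_ge0.
Qed.

Lemma edistance_le x A a : A a -> edistance x A <= enorm (x - a).
Proof.
by move=> Aa; apply: ge_inf; [case: (has_inf_edistance x (ex_intro _ a Aa))|exists a].
Qed.

Lemma edistance_adherent x A e : A !=set0 -> 0 < e ->
  exists2 a, A a & enorm (x - a) < edistance x A + e.
Proof.
move=> A0 e0; have [_ [a Aa <-] ?] := inf_adherent e0 (has_inf_edistance x A0).
by exists a.
Qed.

(* It suffices to check the error bound at points of [K]: move the given point
   to a nearly closest point of [K]. *)
Lemma holder_half_of_sqr K z : K `&` orthv z !=set0 ->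
  (forall rho : R, exists2 kappa, 0 < kappa &
    forall p, K p -> (forall i, `|p 0 i| <= rho) ->
    exists q, [/\ K q, dotv z q = 0 & enorm (p - q) ^+ 2 <= kappa * `|dotv z p|]) ->
  uniform_holder_error_bound K (orthv z) (1 / 2).
Proof.
move=> KH bnd; split => //; first by lra.
move=> S [M0 [_ SM]].
have {M0 SM} [M M0 SM] : exists2 M, 0 <= M & forall x, S x -> `|x| <= M.
  exists (`|M0| + 1); first by rewrite addr_ge0.
  by apply: SM; rewrite (le_lt_trans (ler_norm M0))// ltrDl.
have K0 : K !=set0 by case: KH => q [? _]; exists q.
have H0 : orthv z !=set0 by case: KH => q [_ ?]; exists q.
have [q0 [Kq0 Hq0]] := KH.
pose D := n%:R * (M + `|q0|).
have D0 : 0 <= D by rewrite mulr_ge0// addr_ge0.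
have xq0D x : S x -> enorm (x - q0) <= D.
  move=> /SM xM; apply: enorm_le_coord => [i|]; last by rewrite addr_ge0.
  rewrite !mxE; apply: le_trans (ler_normB _ _) _; apply: lerD.
    exact: le_trans (coord_le_norm x i) xM.
  exact: coord_le_norm.
have [kappa k0 kP] := bnd (M + D + 1).
pose Z := \sum_i `|z 0 i|.
have Z0 : 0 <= Z by apply: sumr_ge0.
pose C := 2 * (D + 1) + 4 * kappa * Z.
have kZ0 : 0 <= kappa * Z by apply: mulr_ge0 => //; exact: ltW.
have C0 : 0 < C by rewrite /C; lra.
exists (Num.sqrt C) => [|x Sx]; first by rewrite sqrtr_gt0.
set d := Num.max _ _.
have dK : edistance x K <= d by rewrite le_max lexx.
have dH : edistance x (orthv z) <= d by rewrite le_max lexx orbT.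
have d0 : 0 <= d by apply: le_trans dK; exact: edistance_ge0.
have dD : d <= D.
  by rewrite ge_max !(le_trans (edistance_le x _) (xq0D _ Sx)).
rewrite div1r powR12_sqrt// -sqrtrM ?(ltW C0)//.
rewrite -[leLHS]ger0_norm; last exact: edistance_ge0.
rewrite -sqrtr_sqr ler_wsqrtr//.
suff H e : 0 < e <= 1 -> edistance x (K `&` orthv z) ^+ 2 <= C * (d + e).
  apply/ler_addgt0Pr => e e0; pose e' := Num.min 1 (e / C).
  have e'0 : 0 < e' by rewrite lt_min ltr01 divr_gt0.
  apply: le_trans (H e' _) _; first by rewrite e'0 ge_min lexx.
  by rewrite mulrDr lerD2l mulrC -ler_pdivlMr// ge_min lexx orbT.
move=> /andP[e0 e1].
have [p Kp xp] := edistance_adherent x K0 e0.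
have [h Hh xh] := edistance_adherent x H0 e0.
have xpd : enorm (x - p) <= d + e by lra.
have xhd : enorm (x - h) <= d + e by lra.
have prho i : `|p 0 i| <= M + D + 1.
  have -> : p 0 i = x 0 i - (x - p) 0 i by rewrite !mxE; ring.
  apply: le_trans (ler_normB _ _) _.
  have : `|x 0 i| <= M.
    exact: le_trans (coord_le_norm x i) (SM _ Sx).
  have := coord_le_enorm (x - p) i; lra.
have [q [Kq Hq pq]] := kP _ Kp prho.
have zp : `|dotv z p| <= 2 * Z * (d + e).
  have -> : dotv z p = dotv z (x - h) - dotv z (x - p).
    by rewrite !dotvB (_ : dotv z h = 0)//; ring.
  apply: le_trans (ler_normB _ _) _.
  have := le_trans (dotv_le_enorm z (x - h)) (ler_wpM2l Z0 xhd).
  have := le_trans (dotv_le_enorm z (x - p)) (ler_wpM2l Z0 xpd).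
  rewrite -/Z; lra.
have xq : enorm (x - q) ^+ 2 <= C * (d + e).
  have -> : x - q = (x - p) + (p - q) by rewrite addrA subrK.
  apply: le_trans (enormD_sqr _ _) _.
  have xp2 : enorm (x - p) ^+ 2 <= (D + 1) * (d + e).
    rewrite expr2; apply: ler_pM; rewrite ?enorm_ge0//; lra.
  have := le_trans pq (ler_wpM2l (ltW k0) zp).
  rewrite /C; lra.
apply: le_trans xq; rewrite lerXn2r ?nnegrE ?enorm_ge0 ?edistance_ge0//.
by apply: edistance_le; split.
Qed.

End EuclideanDistance.

(** * Epigraphs and recession directions *)

Definition epi (R : realType) (f : R -> \bar R) (u a : R) : Prop :=
  (f u <= a%:E)%E.

Definition recession_bound (R : realType) (f : R -> \bar R) (d r : R) : Prop :=
  forall u a c, 0 <= c -> epi f u a -> epi f (u + c * d) (a + c * r).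

Section ConvexFunction.
Variables (R : realType) (f : R -> \bar R).
Hypotheses (f_ge0 : forall x : R, (0%:E <= f x)%E) (f_proper : proper_efun f)
  (f_closed : lower_semicontinuous f) (f_convex : econvex f).
Local Notation E := (epi f).

Lemma epiS u a b : E u a -> a <= b -> E u b.
Proof. by rewrite /epi => /le_trans h ab; apply: h; rewrite lee_fin. Qed.

Lemma epi_ge0 u a : E u a -> 0 <= a.
Proof. by move=> h; rewrite -lee_fin; exact: le_trans (f_ge0 u) h. Qed.

Lemma epi_dom u a : E u a -> dom f u.
Proof. by move=> h; rewrite /dom/=; apply: le_lt_trans h (ltry _). Qed.

Lemma dom_EFin u : dom f u -> f u = (fine (f u))%:E.
Proof.
move=> fu; rewrite fineK// fin_numElt; apply/andP; split => //.
by case: f_proper => + _; apply.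
Qed.

Lemma dom_epi u : dom f u -> E u (fine (f u)).
Proof. by rewrite /epi => /dom_EFin <-. Qed.

Lemma epi_fine u a : E u a -> fine (f u) <= a.
Proof. by move=> h; rewrite -lee_fin -dom_EFin//; exact: epi_dom h. Qed.

Lemma epi_convex u v a b t : E u a -> E v b -> 0 <= t <= 1 ->
  E (t * u + (1 - t) * v) (t * a + (1 - t) * b).
Proof.
rewrite /epi => ua vb t01; apply: le_trans (f_convex _ _ t01) _.
have /andP[t0 t1] := t01.
rewrite [leRHS]EFinD (EFinM t) (EFinM (1 - t)).
by rewrite leeD// lee_wpmul2l// lee_fin; lra.
Qed.

Lemma epi_closed u a :
  (forall e : R, 0 < e -> exists v b : R, [/\ `|v - u| < e, b <= a + e & E v b]) -> E u a.
Proof.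
move=> h; rewrite /epi leNgt; apply/negP => au.
have [m am mu] : exists2 m, a < m & (m%:E < f u)%E.
  move: au; case: (f u) => [r| |//] ar.
    by rewrite lte_fin in ar; exists ((a + r) / 2); rewrite ?lte_fin; lra.
  by exists (a + 1); [lra|exact: ltry].
have [V [e /= e0 eV] Vm] := f_closed mu.
pose e' := Num.min e (m - a).
have e'0 : 0 < e' by rewrite lt_min e0; lra.
have [v [b [vu ba vb]]] := h _ e'0.
have /Vm : V v.
  by apply: eV => /=; rewrite distrC; apply: lt_le_trans vu _; rewrite ge_min lexx.
rewrite ltNge => /negP; apply; apply: le_trans vb _; rewrite lee_fin.
have : e' <= m - a by rewrite ge_min lexx orbT.
lra.
Qed.

Lemma ray_quotient_le y d t m : dom f y -> 0 < t ->
  ((f (y + t * d)%R - f y) * (t^-1)%:E <= m%:E)%E =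
  (f (y + t * d)%R <= (fine (f y) + t * m)%:E)%E.
Proof.
move=> fy t0; rewrite lee_pdivrMr// -EFinM (dom_EFin fy).
by rewrite leeBlDr// -EFinD [m * t + _]addrC [m * t]mulrC.
Qed.

Lemma ray_quotient_nd y d t1 t2 : dom f y -> 0 < t1 <= t2 ->
  ((f (y + t1 * d)%R - f y) * (t1^-1)%:E <=
   (f (y + t2 * d)%R - f y) * (t2^-1)%:E)%E.
Proof.
move=> fy /andP[t10 t12]; have t20 : 0 < t2 by lra.
set Q2 := (X in (_ <= X)%E).
have [->|Q2y] := eqVneq Q2 +oo%E; first exact: leey.
have : (f (y + t2 * d)%R < +oo)%E.
  rewrite ltey; apply/eqP => fy2; move: Q2y; rewrite /Q2 fy2 (dom_EFin fy) addye//.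
  by rewrite gt0_mulye ?eqxx// lte_fin invr_gt0.
move=> /dom_EFin f2.
have -> : Q2 = ((fine (f (y + t2 * d)) - fine (f y)) / t2)%:E.
  by rewrite /Q2 f2 (dom_EFin fy).
rewrite ray_quotient_le//.
have t01 : 0 <= t1 / t2 <= 1.
  by rewrite divr_ge0 ?(ltW t10) ?(ltW t20)//= ler_pdivrMr// mul1r.
have : E (y + t2 * d) (fine (f (y + t2 * d))) by rewrite /epi -f2.
move=> /epi_convex /(_ (dom_epi fy) t01); rewrite /epi.
congr (f _ <= _%:E)%E; field; exact: lt0r_neq0.
Qed.

Lemma recessionP d r : (recession f d <= r%:E)%E <-> recession_bound f d r.
Proof.
rewrite /recession; set y := get (dom f).
have fy : dom f y by case: f_proper => _ /= [x0 fx0]; exact: (getI fx0).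
set Q := fun t : R => ((f (y + t * d)%R - f y) * (t^-1)%:E)%E.
have Qcvg : Q t @[t --> +oo%R] --> ereal_sup (range (fun t => Q (Num.max t 1))).
  have : (Q (Num.max t 1)) @[t --> +oo%R] -->
      ereal_sup (range (fun t => Q (Num.max t 1))).
    apply: nondecreasing_cvge => t1 t2 t12.
    apply: ray_quotient_nd => //; rewrite lt_max ltr01 orbT/=.
    by rewrite ge_max !le_max t12 lexx orbT.
  apply: cvg_trans; apply: near_eq_cvg.
  by near=> t; rewrite max_l//; near: t; exact: nbhs_pinfty_ge.
have -> : lim (Q t @[t --> +oo%R]) = ereal_sup (range (fun t => Q (Num.max t 1))).
  exact: cvg_lim Qcvg.
split=> [supr u a c c0 ua|rb]; last first.
  apply: ge_ereal_sup => _ [t _ <-].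
  have t0 : 0 < Num.max t 1 by rewrite lt_max ltr01 orbT.
  by rewrite /Q ray_quotient_le//; apply: rb (ltW t0) (dom_epi fy).
have yr t : 1 <= t -> E (y + t * d) (fine (f y) + t * r).
  move=> t1; rewrite /epi -ray_quotient_le//; last by lra.
  apply: le_trans supr; apply: ereal_sup_ubound; exists t => //.
  by rewrite max_l.
(* [u + c d] is the limit of [(1 - c / t) u + (c / t) (y + t d)]. *)
apply: epi_closed => e e0.
pose B := `|y - u| + `|fine (f y) - a| + 1.
have B0 : 0 < B by rewrite /B ltr_wpDl ?addr_ge0.
pose t := 1 + c + c * B / e.
have cBe : 0 <= c * B / e by rewrite divr_ge0 ?mulr_ge0 ?(ltW B0) ?(ltW e0).
have t1 : 1 <= t by rewrite /t; lra.
have t0 : 0 < t by lra.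
have ct0 : 0 <= c / t by rewrite divr_ge0 ?(ltW t0).
have ctB : c / t * B < e.
  rewrite mulrAC ltr_pdivrMr// /t.
  have -> : e * (1 + c + c * B / e) = e * (1 + c) + c * B by field; exact: lt0r_neq0.
  rewrite ltrDr mulr_gt0//; lra.
have ct01 : 0 <= c / t <= 1.
  by rewrite ct0 ler_pdivrMr// mul1r /t; lra.
exists (c / t * (y + t * d) + (1 - c / t) * u),
  (c / t * (fine (f y) + t * r) + (1 - c / t) * a); split.
- have -> : c / t * (y + t * d) + (1 - c / t) * u - (u + c * d) = c / t * (y - u).
    by field; exact: lt0r_neq0.
  rewrite normrM (ger0_norm ct0); apply: le_lt_trans ctB.
  by rewrite ler_wpM2l// /B -addrA lerDl addr_ge0.
- have -> : c / t * (fine (f y) + t * r) + (1 - c / t) * a =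
     a + c * r + c / t * (fine (f y) - a) by field; exact: lt0r_neq0.
  rewrite lerD2l; apply: le_trans (ltW ctB); rewrite ler_wpM2l// /B.
  have := ler_norm (fine (f y) - a); have := normr_ge0 (y - u); lra.
- exact: epi_convex (yr _ t1) ua ct01.
Unshelve. all: by end_near.
Qed.

End ConvexFunction.

(** * The cone of the perspective *)

Section Cone.
Variables (R : realType) (f : R -> \bar R).
Hypotheses (f_ge0 : forall x : R, (0%:E <= f x)%E) (f_proper : proper_efun f)
  (f_closed : lower_semicontinuous f) (f_convex : econvex f).
Local Notation E := (epi f).
Local Notation K := (epi_perspective f).

Definition vec3 (x t r : R) : 'rV[R]_3 := \row_i [:: x; t; r]`_i.

Lemma vec3_0 x t r : vec3 x t r 0 0 = x. Proof. by rewrite mxE. Qed.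
Lemma vec3_1 x t r : vec3 x t r 0 1 = t. Proof. by rewrite mxE. Qed.
Lemma vec3_2 x t r : vec3 x t r 0 2 = r. Proof. by rewrite mxE. Qed.
Definition vec3E := (vec3_0, vec3_1, vec3_2).

Lemma ord3P (P : 'I_3 -> Prop) : P 0 -> P 1 -> P 2 -> forall i, P i.
Proof.
move=> P0 P1 P2 [[|[|[|//]]] i3].
- by rewrite (_ : Ordinal i3 = 0)//; exact: val_inj.
- by rewrite (_ : Ordinal i3 = 1)//; exact: val_inj.
- by rewrite (_ : Ordinal i3 = 2)//; exact: val_inj.
Qed.

Lemma vec3_eta (v : 'rV[R]_3) : v = vec3 (v 0 0) (v 0 1) (v 0 2).
Proof. by apply/rowP; apply: ord3P; rewrite vec3E. Qed.

Lemma dotv3 (z p : 'rV[R]_3) :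
  dotv z p = z 0 0 * p 0 0 + z 0 1 * p 0 1 + z 0 2 * p 0 2.
Proof.
rewrite /dotv !big_ord_recr big_ord0/= add0r.
by congr (_ * _ + _ * _ + _ * _); congr (_ 0 _); exact: val_inj.
Qed.

Lemma epi_perspectiveP (v : 'rV[R]_3) : K v <->
  (0 < v 0 1 /\ E (v 0 0 / v 0 1) (v 0 2 / v 0 1)) \/
  (v 0 1 = 0 /\ recession_bound f (v 0 0) (v 0 2)).
Proof.
rewrite /epi_perspective/= /closed_perspective.
have [t0|t0|/esym t0] := ltgtP 0 (v 0 1).
- rewrite -[X in (_ <= X%:E)%E](mulfVK (lt0r_neq0 t0)) [_ / _ * _]mulrC EFinM.
  rewrite lee_pmul2l ?lte_fin//.
  split; first by left.
  by case=> [[]//|[v1]]; rewrite v1 ltxx in t0.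
- by rewrite leye_eq; split => // -[[]//|[v1]]; rewrite v1 ltxx in t0.
- rewrite recessionP//; split; first by right.
  by case=> -[].
Qed.

Lemma epi_perspective_scale a v : 0 < a -> K v -> K (a *: v).
Proof.
move=> a0 /epi_perspectiveP Kv; apply/epi_perspectiveP; rewrite !mxE.
case: Kv => -[t0 vE].
  left; rewrite mulr_gt0//; split => //.
  by rewrite -!mulf_div divff ?lt0r_neq0// !mul1r.
right; rewrite t0 mulr0; split => // u b c c0 ub.
by rewrite !mulrA; apply: vE => //; rewrite mulr_ge0// ltW.
Qed.

Lemma epi_perspective_add v w : K v -> K w -> K (v + w).
Proof.
wlog vw : v w / w 0 1 <= v 0 1.
  move=> H; have [|/ltW] := leP (w 0 1) (v 0 1); first exact: H.
  by move=> vw Kv Kw; rewrite addrC; exact: H.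
move=> /epi_perspectiveP Kv /epi_perspectiveP Kw; apply/epi_perspectiveP.
rewrite !mxE; case: Kv => -[v0 vE].
  have v1 := lt0r_neq0 v0.
  left; case: Kw => -[w0 wE].
    split; first by rewrite addr_gt0.
    have vw0 : v 0 1 + w 0 1 != 0 by rewrite lt0r_neq0// addr_gt0.
    have w1 := lt0r_neq0 w0.
    have t01 : 0 <= v 0 1 / (v 0 1 + w 0 1) <= 1.
      rewrite ler_pdivrMr ?addr_gt0// mul1r lerDl (ltW w0) andbT.
      by rewrite divr_ge0 ?addr_ge0// ltW.
    have := epi_convex f_convex vE wE t01.
    by congr epi; field; rewrite ?vw0 ?v1 ?w1.
  split; first by rewrite w0 addr0.
  rewrite w0 addr0 !mulrDl [w 0 0 * _]mulrC [w 0 2 * _]mulrC.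
  by apply: wE => //; rewrite invr_ge0 ltW.
case: Kw => -[w0 wE]; first by rewrite v0 leNgt w0 in vw.
right; rewrite v0 w0 addr0; split => // u a c c0 ua.
by rewrite !mulrDr !addrA; apply: wE => //; exact: vE.
Qed.

Lemma recession_bound0 r : 0 <= r -> recession_bound f 0 r.
Proof.
move=> r0 u a c c0 ua; rewrite mulr0 addr0; apply: epiS ua _.
by rewrite lerDl mulr_ge0.
Qed.

Lemma epi_perspective_lift u a t : 0 <= t -> E u a -> K (vec3 (t * u) t (t * a)).
Proof.
rewrite le_eqVlt => /predU1P[<-|t0] ua; apply/epi_perspectiveP; rewrite !vec3E.
  by right; split => //; rewrite !mul0r; exact: recession_bound0.
by left; split => //; rewrite ![t * _]mulrC !mulfK// lt0r_neq0.
Qed.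

Lemma epi_perspective_recession d r : recession_bound f d r -> K (vec3 d 0 r).
Proof. by move=> dr; apply/epi_perspectiveP; rewrite !vec3E; right. Qed.

Lemma affine_ge0 (A B : R) : (forall c, 0 <= c -> 0 <= A + c * B) -> 0 <= B.
Proof.
move=> H; rewrite leNgt; apply/negP => B0.
have NB0 : 0 < - B by lra.
have : 0 <= (`|A| + 1) / - B by rewrite divr_ge0 ?addr_ge0// ltW.
move=> /H; have -> : (`|A| + 1) / - B * B = - (`|A| + 1).
  by field; exact: ltr0_neq0.
have := ler_norm A; lra.
Qed.

Lemma epi_perspective_linear z1 z2 z3 v :
  (forall u a, E u a -> 0 <= z1 * u + z2 + z3 * a) -> K v ->
  0 <= z1 * v 0 0 + z2 * v 0 1 + z3 * v 0 2.
Proof.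
move=> H /epi_perspectiveP[[t0 vE]|[-> vE]].
  have := mulr_ge0 (ltW t0) (H _ _ vE).
  by congr (_ <= _); field; exact: lt0r_neq0.
have [y /dom_epi-/(_ f_proper) fy] : dom f !=set0 by case: f_proper.
rewrite mulr0 addr0; apply: (@affine_ge0 (z1 * y + z2 + z3 * fine (f y))) => c c0.
have := H _ _ (vE _ _ _ c0 fy).
by congr (_ <= _); ring.
Qed.

Lemma epi_perspective_t_ge0 v : K v -> 0 <= v 0 1.
Proof. by move=> /epi_perspectiveP[[/ltW]|[->]]. Qed.

Lemma epi_perspective_r_ge0 v : K v -> 0 <= v 0 2.
Proof.
move=> Kv; have := @epi_perspective_linear 0 0 1 v _ Kv.
rewrite !mul0r mul1r !add0r; apply => u a /(epi_ge0 f_ge0); lra.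
Qed.

Lemma epi_perspective_interior : (dom f)° !=set0 -> K° !=set0.
Proof.
case=> x0 /nbhs_ballP[e /= e0 eD].
have dm u : `|u - x0| < e -> dom f u by move=> ue; apply: eD; rewrite /ball/= distrC.
pose h := e / 2.
have h0 : 0 < h by rewrite /h; lra.
pose M := Num.max (fine (f (x0 - h))) (fine (f (x0 + h))).
have EM u : `|u - x0| <= h -> E u M.
  rewrite ler_norml => /andP[uh1 uh2].
  have E1 : E (x0 - h) M.
    have : dom f (x0 - h).
      by apply: dm; rewrite addrAC subrr sub0r normrN gtr0_norm// /h; lra.
    by move=> /(dom_epi f_proper)/epiS; apply; rewrite le_max lexx.
  have E2 : E (x0 + h) M.
    have : dom f (x0 + h).
      by apply: dm; rewrite addrAC subrr add0r gtr0_norm// /h; lra.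
    by move=> /(dom_epi f_proper)/epiS; apply; rewrite le_max lexx orbT.
  have t01 : 0 <= (x0 + h - u) / (2 * h) <= 1.
    apply/andP; split; last by rewrite ler_pdivrMr ?mulr_gt0//; lra.
    by apply: divr_ge0; lra.
  have := epi_convex f_convex E1 E2 t01.
  by congr epi; field; exact: lt0r_neq0.
have M0 : 0 <= M.
  by apply: (epi_ge0 f_ge0) (EM x0 _); rewrite subrr normr0 ltW.
pose r := Num.min (2^-1) (Num.min (h / (2 * (1 + `|x0|))) (M + 1)^-1).
have x01 : 0 < 1 + `|x0| by have := normr_ge0 x0; lra.
have r0 : 0 < r.
  by rewrite !lt_min invr_gt0 ltr0n/= divr_gt0 ?mulr_gt0//= invr_gt0; lra.
have r2 : r <= 2^-1 by rewrite ge_min lexx.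
have rh : r * (2 * (1 + `|x0|)) <= h.
  by rewrite -ler_pdivlMr ?mulr_gt0// !ge_min lexx orbT.
have rM : r * (M + 1) <= 1.
  rewrite -ler_pdivlMr; last by lra.
  by rewrite mul1r !ge_min lexx !orbT.
exists (vec3 x0 1 (M + 1)); apply/nbhs_ballP; exists r => //= v.
rewrite mx_norm_ball /ball_/= => vr.
have vi i : `|vec3 x0 1 (M + 1) 0 i - v 0 i| < r.
  by apply: le_lt_trans vr; have := coord_le_norm (vec3 x0 1 (M + 1) - v) i; rewrite !mxE.
have := vi 0; have := vi 1; have := vi 2; rewrite !vec3E.
move=> /ltW + /ltW + /ltW; rewrite !ler_norml => /andP[v2 v2'] /andP[v1 v1'] v0.
have t0 : 0 < v 0 1 by lra.
apply/epi_perspectiveP; left; split => //.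
apply: (@epiS _ _ _ M); last first.
  rewrite ler_pdivlMr//.
  have : M * v 0 1 <= M * (1 + r) by rewrite ler_wpM2l//; lra.
  lra.
apply: EM.
have -> : v 0 0 / v 0 1 - x0 = (v 0 0 - v 0 1 * x0) / v 0 1.
  by field; exact: lt0r_neq0.
rewrite normrM normfV (gtr0_norm t0) ler_pdivrMr//.
have -> : v 0 0 - v 0 1 * x0 = - (x0 - v 0 0) + (1 - v 0 1) * x0 by ring.
apply: le_trans (ler_normD _ _) _; rewrite normrN normrM.
have a1 : `|x0 - v 0 0| <= r by rewrite ler_norml.
have : `|1 - v 0 1| * `|x0| <= r * `|x0|.
  by rewrite ler_wpM2r// ler_norml v1.
have : h * 2^-1 <= h * v 0 1 by rewrite ler_wpM2l ?(ltW h0)//; lra.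
lra.
Qed.

(* A hyperplane that misses the interior of the cone [K] supports it: otherwise
   it would contain a positive combination of an interior point and a point of
   [K] on the other side. *)
Lemma weakly_feasible_dual z : (dom f)° !=set0 ->
  nontrivially_weakly_feasible (orthv z) K ->
  (exists2 e : R, e != 0 & forall p, K p -> 0 <= dotv (e *: z) p) /\
  exists2 p, K p & p <> 0 /\ dotv z p = 0.
Proof.
move=> /epi_perspective_interior[e0 Ke0] [[q [Hq Kq]] Hint Hnz]; split; last first.
  apply: contrapT => H; apply: Hnz; apply/seteqP.
  have K0 p : (orthv z `&` K) p -> p = 0.
    by move=> [zp Kp]; apply: contrapT => p0; apply: H; exists p.
  by split => p; [exact: K0 | move=> ->; rewrite -(K0 q)].
have disj v : orthv z v -> K° v -> False.
  by move=> v1 v2; have : (orthv z `&` K°) v by []; rewrite Hint.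
have intK a p : 0 < a -> K p -> K° (a *: e0 + p).
  move=> a0 Kp; have /nbhs_ballP[d /= d0 dK] := Ke0.
  apply/nbhs_ballP; exists (a * d) => /=; first exact: mulr_gt0.
  move=> v; rewrite mx_norm_ball /ball_/= => vd.
  have -> : v = a *: (a^-1 *: (v - p)) + p.
    by rewrite scalerA divff ?lt0r_neq0// scale1r subrK.
  apply: epi_perspective_add => //; apply: epi_perspective_scale => //; apply: dK.
  rewrite mx_norm_ball /ball_/=.
  have -> : e0 - a^-1 *: (v - p) = a^-1 *: (a *: e0 + p - v).
    rewrite -[in RHS]addrA [in RHS]scalerDr scalerA mulVf ?lt0r_neq0// scale1r.
    congr (_ + _).
    by rewrite -scalerN opprB.
  by rewrite normrZ gtr0_norm ?invr_gt0// ltr_pdivrMl.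
have ze0 : dotv z e0 != 0 by apply/eqP => ze; exact: (disj e0).
exists (Num.sg (dotv z e0)); first by rewrite sgr_eq0.
move=> p Kp; rewrite leNgt; apply/negP.
rewrite dotZv.
have [ze|ze|/eqP] := ltgtP (dotv z e0) 0; last by rewrite (negPf ze0).
  rewrite ltr0_sg// mulN1r oppr_lt0 => zp.
  apply: (disj ((dotv z p / - dotv z e0) *: e0 + p)); last first.
    by apply: intK => //; rewrite divr_gt0// oppr_gt0.
  by rewrite /orthv/= dotvD dotvZ; field.
rewrite gtr0_sg// mul1r => zp.
apply: (disj ((- dotv z p / dotv z e0) *: e0 + p)); last first.
  by apply: intK => //; rewrite divr_gt0// oppr_gt0.
by rewrite /orthv/= dotvD dotvZ; field.
Qed.

End Cone.

Section ErrorBounds.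
Variables (R : realType) (f : R -> \bar R).
Hypotheses (f_ge0 : forall x : R, (0%:E <= f x)%E) (f_proper : proper_efun f)
  (f_closed : lower_semicontinuous f) (f_convex : econvex f).
Local Notation E := (epi f).
Local Notation K := (epi_perspective f).

Lemma holder_half_of_lipschitz n (A : set 'rV[R]_n) z (L : R) :
  A `&` orthv z !=set0 ->
  (forall p, A p -> exists q, [/\ A q, dotv z q = 0 &
     forall i, `|(p - q) 0 i| <= L * `|dotv z p|]) ->
  uniform_holder_error_bound A (orthv z) (1 / 2).
Proof.
move=> AH lip; apply: holder_half_of_sqr => // rho.
pose Z := \sum_i `|z 0 i|.
have Z0 : 0 <= Z by apply: sumr_ge0.
pose B := Z * (n%:R * `|rho|).
have B0 : 0 <= B by rewrite !mulr_ge0.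
pose L' := `|L|.
exists ((n%:R * L') ^+ 2 * B + 1) => [|p Ap prho].
  by rewrite ltr_wpDl// mulr_ge0// sqr_ge0.
have [q [Aq zq pq]] := lip p Ap; exists q; split => //.
set m := `|dotv z p|; have m0 : 0 <= m by exact: normr_ge0.
have mB : m <= B.
  apply: le_trans (dotv_le_enorm z p) _; rewrite ler_wpM2l//.
  by apply: enorm_le_coord => // i; apply: le_trans (prho i) (ler_norm _).
have : enorm (p - q) <= n%:R * (L' * m).
  apply: enorm_le_coord; last by rewrite mulr_ge0 ?normr_ge0.
  by move=> i; apply: le_trans (pq i) _; rewrite ler_wpM2r// ler_norm.
rewrite mulrA => pqm.
have : enorm (p - q) ^+ 2 <= (n%:R * L' * m) ^+ 2.
  by rewrite lerXn2r ?nnegrE ?enorm_ge0 ?mulr_ge0 ?normr_ge0.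
move=> /le_trans; apply; rewrite exprMn [m ^+ 2]expr2 mulrA mulrDl mul1r.
rewrite -[leLHS]addr0 lerD// -[in leRHS]mulrA [B * m]mulrC mulrA.
by rewrite ler_wpM2l// mulr_ge0// sqr_ge0.
Qed.

Lemma holder_half_vertical (z1 z2 c : R) : 0 < c ->
  (forall u, dom f u -> c * (1 + `|u|) <= z1 * u + z2) ->
  uniform_holder_error_bound K (orthv (vec3 z1 z2 0)) (1 / 2).
Proof.
move=> c0 dc.
have Hq r : dotv (vec3 z1 z2 0) (vec3 0 0 r) = 0.
  by rewrite dotv3 !vec3E; ring.
apply: (@holder_half_of_lipschitz _ _ _ c^-1).
  exists (vec3 0 0 0); split; last exact: Hq.
  exact/epi_perspective_recession/recession_bound0.
move=> p Kp; exists (vec3 0 0 (p 0 2)).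
split => //.
  apply: epi_perspective_recession => //; apply: recession_bound0.
  exact: epi_perspective_r_ge0.
have := epi_perspective_t_ge0 f_proper f_closed f_convex Kp.
have := @epi_perspective_linear _ f f_proper f_closed f_convex (z1 - c) (z2 - c) 0 p _ Kp.
have := @epi_perspective_linear _ f f_proper f_closed f_convex (z1 + c) (z2 - c) 0 p _ Kp.
move=> h1 h2 t0.
have {h1}h1 : 0 <= (z1 + c) * p 0 0 + (z2 - c) * p 0 1 + 0 * p 0 2.
  apply: h1 => u a /epi_dom/dc.
  have : c * - u <= c * `|u| by rewrite ler_pM2l// -normrN ler_norm.
  lra.
have {h2}h2 : 0 <= (z1 - c) * p 0 0 + (z2 - c) * p 0 1 + 0 * p 0 2.
  apply: h2 => u a /epi_dom/dc.
  have : c * u <= c * `|u| by rewrite ler_pM2l// ler_norm.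
  lra.
have zp : dotv (vec3 z1 z2 0) p = z1 * p 0 0 + z2 * p 0 1.
  by rewrite dotv3 !vec3E; ring.
have ct : 0 <= c * p 0 1 by rewrite mulr_ge0// ltW.
have cx : c * `|p 0 0| + c * p 0 1 <= `|dotv (vec3 z1 z2 0) p|.
  rewrite zp; apply: le_trans (ler_norm _).
  by case: (ger0P (p 0 0)) => _; lra.
apply: ord3P; rewrite !mxE/= ?subr0 ler_pdivlMl//.
- lra.
- by rewrite ger0_norm//; have := mulr_ge0 (ltW c0) (normr_ge0 (p 0 0)); lra.
- by rewrite subrr normr0 mulr0.
Qed.

Lemma recession_bound_scale d r a : 0 <= a -> recession_bound f d r ->
  recession_bound f (a * d) (a * r).
Proof.
move=> a0 dr u b c c0 ub; rewrite !mulrA; apply: dr => //; exact: mulr_ge0.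
Qed.

Lemma holder_half_recession (d y w dl c u1 : R) : d ^+ 2 = 1 ->
  recession_bound f d (y * d) -> 0 < dl -> 0 < c ->
  (forall u a, E u a -> dl <= a - y * u + w) ->
  (forall u a, E u a -> c * ((u1 - u) * d) <= a - y * u + w) ->
  uniform_holder_error_bound K (orthv (vec3 (- y) w 1)) (1 / 2).
Proof.
move=> d1 dy dl0 c0 gdl gc.
have dotE p : dotv (vec3 (- y) w 1) p = p 0 2 - y * p 0 0 + w * p 0 1.
  by rewrite dotv3 !vec3E; ring.
have Krec a : 0 <= a * d -> K (vec3 a 0 (y * a)).
  move=> ad; apply: epi_perspective_recession => //.
  have := recession_bound_scale ad dy.
  by rewrite mulrCA -!mulrA -!expr2 d1 !mulr1.
have zrec a : dotv (vec3 (- y) w 1) (vec3 a 0 (y * a)) = 0.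
  by rewrite dotE !vec3E; ring.
pose A := c^-1 + `|u1| / dl.
have iA : 0 <= c^-1 by rewrite invr_ge0 ltW.
have iD : 0 <= dl^-1 by rewrite invr_ge0 ltW.
have iU : 0 <= `|u1| / dl by rewrite mulr_ge0.
have A0 : 0 <= A by rewrite addr_ge0.
have iy : 0 <= `|y| * A by rewrite mulr_ge0.
have iw : 0 <= `|w| / dl by rewrite mulr_ge0.
pose L := 1 + A + dl^-1 + `|y| * A + `|w| / dl.
apply: (@holder_half_of_lipschitz _ _ _ L).
  by exists (vec3 0 0 (y * 0)); split; [apply: Krec; rewrite mul0r|exact: zrec].
move=> p Kp; have t0 := epi_perspective_t_ge0 f_proper f_closed f_convex Kp.
have h1 : 0 <= (- y) * p 0 0 + (w - dl) * p 0 1 + 1 * p 0 2.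
  apply: (@epi_perspective_linear _ f) => // u a /gdl; lra.
have h2 : 0 <= (- y + c * d) * p 0 0 + (w - c * u1 * d) * p 0 1 + 1 * p 0 2.
  apply: (@epi_perspective_linear _ f) => // u a /gc; lra.
rewrite dotE; set m := p 0 2 - _ + _.
have dlt : 0 <= dl * p 0 1 by rewrite mulr_ge0// ltW.
have m0 : 0 <= m by rewrite /m; lra.
rewrite (ger0_norm m0).
have tm : p 0 1 <= dl^-1 * m by rewrite ler_pdivlMl// /m; lra.
have wt : `|w * p 0 1| <= `|w| / dl * m.
  by rewrite normrM (ger0_norm t0) -mulrA ler_wpM2l.
have Am : 0 <= A * m by rewrite mulr_ge0.
have Dm : 0 <= dl^-1 * m by rewrite mulr_ge0.
have ym : 0 <= `|y| * A * m by rewrite mulr_ge0.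
have wm : 0 <= `|w| / dl * m by rewrite mulr_ge0.
have LE : L * m = m + A * m + dl^-1 * m + `|y| * A * m + `|w| / dl * m.
  by rewrite /L; ring.
have [Xd|Xd] := leP 0 (p 0 0 * d).
  exists (vec3 (p 0 0) 0 (y * p 0 0)); split; [exact: Krec|exact: zrec|].
  apply: ord3P; rewrite !mxE/= LE.
  - by rewrite subrr normr0; lra.
  - by rewrite subr0 ger0_norm//; lra.
  - have -> : p 0 2 - y * p 0 0 = m - w * p 0 1 by rewrite /m; ring.
    apply: le_trans (ler_normB _ _) _; rewrite (ger0_norm m0); lra.
have absd : `|d| = 1.
  by apply/eqP; rewrite -sqr_norm_eq1 d1.
have Xm : `|p 0 0| <= A * m.
  have -> : `|p 0 0| = - (p 0 0 * d).
    by rewrite -(ltr0_norm Xd) normrM absd mulr1.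
  have : c * - (p 0 0 * d) <= m - c * (u1 * d * p 0 1) by rewrite /m; lra.
  rewrite -ler_pdivlMl// mulrBr mulKf ?lt0r_neq0// => hX.
  apply: le_trans hX _.
  rewrite /A mulrDl lerD2l; apply: le_trans (ler_norm _) _.
  rewrite normrN !normrM absd mulr1 (ger0_norm t0) -mulrA ler_wpM2l//.
exists (vec3 0 0 (y * 0)); split; [by apply: Krec; rewrite mul0r|exact: zrec|].
apply: ord3P; rewrite !mxE/= ?mulr0 ?subr0 LE.
- lra.
- by rewrite ger0_norm//; lra.
- have -> : p 0 2 = m + (y * p 0 0 - w * p 0 1) by rewrite /m; ring.
  apply: le_trans (ler_normD _ _) _; rewrite (ger0_norm m0).
  have := ler_normB (y * p 0 0) (w * p 0 1); rewrite [`|y * _|]normrM.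
  have : `|y| * `|p 0 0| <= `|y| * A * m by rewrite -mulrA ler_wpM2l.
  lra.
Qed.

Lemma holder_half_strongly_convex (x a0 y c dl : R) : 0 < c -> 0 < dl ->
  E x a0 ->
  (forall u a, E u a -> 0 <= a - a0 - y * (u - x)) ->
  (forall u a, E u a -> `|u - x| <= dl -> c * (u - x) ^+ 2 <= a - a0 - y * (u - x)) ->
  (forall u a, E u a -> dl <= `|u - x| -> c * `|u - x| <= a - a0 - y * (u - x)) ->
  uniform_holder_error_bound K (orthv (vec3 (- y) (y * x - a0) 1)) (1 / 2).
Proof.
move=> c0 dl0 xa0 g0 gin gout.
have dotE p : dotv (vec3 (- y) (y * x - a0) 1) p =
    p 0 2 - a0 * p 0 1 - y * (p 0 0 - p 0 1 * x).
  by rewrite dotv3 !vec3E; ring.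
have Klift t : 0 <= t -> K (vec3 (t * x) t (t * a0)).
  by move=> t0; exact: epi_perspective_lift.
have zlift t : dotv (vec3 (- y) (y * x - a0) 1) (vec3 (t * x) t (t * a0)) = 0.
  by rewrite dotE !vec3E; ring.
apply: holder_half_of_sqr.
  by exists (vec3 (0 * x) 0 (0 * a0)); split; [exact: Klift|exact: zlift].
move=> rho; pose r := `|rho|; have r0 : 0 <= r by exact: normr_ge0.
pose B := r * ((1 + `|x|)).
have B0 : 0 <= B by rewrite mulr_ge0// addr_ge0.
pose M := r * (1 + `|a0|) + `|y| * B.
have M0 : 0 <= M by rewrite addr_ge0 ?mulr_ge0 ?addr_ge0.
pose kappa := (1 + 2 * y ^+ 2) * (B / c) + 2 * M + 1.
have Bc0 : 0 <= B / c by rewrite divr_ge0// ltW.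
exists kappa => [|p Kp prho].
  rewrite /kappa ltr_wpDl//; apply: addr_ge0; last by rewrite mulr_ge0.
  by apply: mulr_ge0 => //; rewrite addr_ge0// mulr_ge0// sqr_ge0.
have t0 := epi_perspective_t_ge0 f_proper f_closed f_convex Kp.
exists (vec3 (p 0 1 * x) (p 0 1) (p 0 1 * a0)); split; [exact: Klift|exact: zlift|].
have h0 : 0 <= (- y) * p 0 0 + (y * x - a0) * p 0 1 + 1 * p 0 2.
  apply: (@epi_perspective_linear _ f) => // u a /g0; lra.
rewrite dotE; set D := p 0 0 - p 0 1 * x; set m := p 0 2 - _ - _.
have m0 : 0 <= m by rewrite /m /D; lra.
rewrite (ger0_norm m0).
have pr i : `|p 0 i| <= r by apply: le_trans (prho i) (ler_norm _).
have tr : p 0 1 <= r by apply: le_trans (ler_norm _) (pr 1).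
have DB : `|D| <= B.
  apply: le_trans (ler_normB _ _) _; rewrite /B mulrDr mulr1 lerD//.
  by rewrite normrM ler_wpM2r.
have mM : m <= M.
  apply: le_trans (ler_norm _) _; apply: le_trans (ler_normB _ _) _.
  rewrite /M; apply: lerD; last by rewrite normrM ler_wpM2l.
  apply: le_trans (ler_normB _ _) _; rewrite mulrDr mulr1 lerD//.
  by rewrite normrM mulrC ler_wpM2r.
have Dlin : c * `|D| <= m -> c * D ^+ 2 <= B * m.
  move=> cD; have : `|D| * (c * `|D|) <= B * m.
    by apply: ler_pM => //; rewrite mulr_ge0// ltW.
  by rewrite mulrCA -expr2 real_normK ?num_real.
have D2 : c * D ^+ 2 <= B * m.
  have [tp|tn] := ltP 0 (p 0 1); last first.
    have tE : p 0 1 = 0 by apply/eqP; rewrite eq_le tn t0.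
    apply: Dlin.
    have gl u a s : `|s| <= 1 -> E u a ->
        0 <= a - a0 - y * (u - x) - c * (s * (u - x) - dl).
      move=> s1 ua; have su : s * (u - x) <= `|u - x|.
        by apply: le_trans (ler_norm _) _; rewrite normrM ler_piMl.
      have [ux|ux] := leP dl `|u - x|.
        have := gout _ _ ua ux.
        have : c * (s * (u - x) - dl) <= c * `|u - x| by rewrite ler_pM2l//; lra.
        lra.
      have := g0 _ _ ua.
      have : c * (s * (u - x) - dl) <= 0 by rewrite pmulr_rle0//; lra.
      lra.
    have hl s : `|s| <= 1 -> 0 <= (- y - c * s) * p 0 0 +
        (y * x - a0 + c * (s * x + dl)) * p 0 1 + 1 * p 0 2.
      move=> s1; apply: (@epi_perspective_linear _ f) => // u a /(gl _ _ _ s1); lra.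
    have := hl 1; have := hl (-1); rewrite normrN normr1 tE.
    move=> /(_ (lexx _)) h1 /(_ (lexx _)) h2.
    rewrite /m /D tE mul0r subr0 mulr0 subr0.
    by case: (ger0P (p 0 0)) => _; lra.
  move: Kp => /epi_perspectiveP[//|//|//|[_ pE]|[tE _]]; last by rewrite tE ltxx in tp.
  have t1 := lt0r_neq0 tp.
  have uxD : p 0 0 / p 0 1 - x = D / p 0 1 by rewrite /D; field.
  have gm : p 0 2 / p 0 1 - a0 - y * (p 0 0 / p 0 1 - x) = m / p 0 1.
    by rewrite /m /D; field.
  have [ux|ux] := leP `|p 0 0 / p 0 1 - x| dl.
    have := gin _ _ pE ux; rewrite gm uxD expr_div_n.
    move=> /(ler_wpM2l (sqr_ge0 (p 0 1))).
    have -> : p 0 1 ^+ 2 * (c * (D ^+ 2 / p 0 1 ^+ 2)) = c * D ^+ 2 by field.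
    have -> : p 0 1 ^+ 2 * (m / p 0 1) = p 0 1 * m by field.
    move=> /le_trans; apply; rewrite ler_wpM2r//.
    apply: le_trans tr _; rewrite /B ler_peMr// lerDl//.
  apply: Dlin; have := gout _ _ pE (ltW ux); rewrite gm uxD normrM normfV (gtr0_norm tp).
  move=> /(ler_wpM2l t0).
  have -> : p 0 1 * (c * (`|D| / p 0 1)) = c * `|D| by field.
  by have -> : p 0 1 * (m / p 0 1) = m by field.
rewrite enorm_sqr dotv3 !mxE/=.
have -> : p 0 2 - p 0 1 * a0 = m + y * D by rewrite /m; ring.
rewrite -/D subrr.
have {}D2 : D ^+ 2 <= B / c * m by rewrite mulrAC ler_pdivlMr// mulrC.
have y2 : 0 <= y ^+ 2 by exact: sqr_ge0.
have : y ^+ 2 * D ^+ 2 <= y ^+ 2 * (B / c * m) by rewrite ler_wpM2l.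
have : m * m <= M * m by rewrite ler_wpM2r.
have := sqr_ge0 (m - y * D).
rewrite /kappa; lra.
Qed.

End ErrorBounds.

(** * Subgradients and strong convexity *)

Lemma derive1_dir_ge (R : realType) (g : R -> R) (x v m d : R) : v != 0 ->
  derivable g x 1 -> 0 < d ->
  (forall h, 0 < h < d -> h * m <= g (x + h * v) - g x) ->
  m <= derive1 g x * v.
Proof.
move=> v0 gx d0 gm; apply/ler_addgt0Pr => e e0.
have nv0 : 0 < `|v| by rewrite normr_gt0.
have g1 : h^-1 *: (g (h + x) - g x) @[h --> 0^'] --> derive1 g x.
  have gE : (fun h : R => h^-1 *: ((g \o shift x) (h *: 1) - g x)) =
      (fun h => h^-1 *: (g (h + x) - g x)).
    by apply/funext => h; rewrite /= /GRing.scale/= mulr1.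
  by move: gx; rewrite /derivable gE.
have := (cvgrPdist_lt _ _).1 g1 (e / `|v|) (divr_gt0 e0 nv0).
rewrite near_withinE => -[r /= r0 H].
pose h := Num.min (d / 2) (r / (2 * `|v|)).
have h0 : 0 < h by rewrite lt_min !divr_gt0// mulr_gt0.
have hd : h < d.
  by apply: le_lt_trans (_ : d / 2 < d); [rewrite ge_min lexx|lra].
have hv0 : h * v != 0 by rewrite mulf_neq0// lt0r_neq0.
have hvr : `|h * v| < r.
  rewrite normrM (gtr0_norm h0).
  apply: le_lt_trans (_ : r / 2 < r); last by lra.
  by rewrite -ler_pdivlMr// -mulrA -invfM ge_min lexx orbT.
have : `|derive1 g x - (h * v)^-1 *: (g (h * v + x) - g x)| < e / `|v|.
  by apply: H => //; rewrite /ball/= sub0r normrN.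
rewrite ltr_pdivlMr// -normrM => He.
have /gm : 0 < h < d by rewrite h0.
set G := g (x + h * v) - g x => Gm.
have : `|derive1 g x * v - h^-1 * G| < e.
  apply: le_lt_trans He; rewrite /G [x + _]addrC.
  rewrite le_eqVlt; apply/orP; left; apply/eqP; congr `|_|.
  rewrite /GRing.scale/= mulrBl; congr (_ - _); field.
  by rewrite v0 lt0r_neq0.
rewrite ltr_norml => /andP[+ _]; have : m <= h^-1 * G by rewrite ler_pdivlMl.
lra.
Qed.

Lemma derive1_dir_le (R : realType) (g : R -> R) (x v m d : R) : v != 0 ->
  derivable g x 1 -> 0 < d ->
  (forall h, 0 < h < d -> g (x + h * v) - g x <= h * m) ->
  derive1 g x * v <= m.
Proof.
move=> v0 gx d0 gm; rewrite -lerN2 -mulNr.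
have -> : - derive1 g x = derive1 (- g) x.
  by rewrite !derive1E deriveN.
apply: (@derive1_dir_ge _ _ _ _ _ d) => //; first exact: derivableN.
by move=> h /gm; rewrite !fctE mulrN; lra.
Qed.

Lemma nbhs_avoid_finite (R : realType) (W : set R) (x : R) : finite_set W ->
  exists2 e : R, 0 < e & forall y, `|y - x| < e -> y != x -> ~ W y.
Proof.
move=> Wfin.
have cl : closed (W `\ x).
  by move: (W `\ x) (finite_setD [set x] Wfin); apply/accessible_finite_set_closed;
     exact: hausdorff_accessible (@norm_hausdorff _ R).
have : (~` (W `\ x))° x.
  by move: (closed_openC cl); rewrite openE; apply => -[_]; apply.
move=> [e /= e0 He]; exists e => // y yx ynx Wy.
apply: (He y); first by rewrite /= distrC.
by split => // yE; rewrite yE eqxx in ynx.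
Qed.

Section Subgradients.
Variables (R : realType) (f : R -> \bar R).
Hypotheses (f_ge0 : forall x : R, (0%:E <= f x)%E) (f_proper : proper_efun f)
  (f_closed : lower_semicontinuous f) (f_convex : econvex f)
  (f_smooth : essentially_smooth f).
Local Notation E := (epi f).

Lemma interior_domP x : (dom f)° x <->
  exists2 e : R, 0 < e & forall y, `|y - x| < e -> dom f y.
Proof.
split=> [[e /= e0 He]|[e e0 He]]; exists e => // y.
  by move=> yx; apply: He; rewrite /= distrC.
by rewrite /= distrC => /He.
Qed.

Lemma interior_dom_convex x c t : dom f x -> (dom f)° c -> 0 < t <= 1 ->
  (dom f)° ((1 - t) * x + t * c).
Proof.
move=> fx /interior_domP[e e0 ce] /andP[t0 t1]; apply/interior_domP.
exists (t * e) => [|y]; first exact: mulr_gt0.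
set u := (1 - t) * x + t * c => yu.
have fc : dom f (c + (y - u) / t).
  apply: ce; rewrite addrAC subrr add0r normrM normfV (gtr0_norm t0).
  by rewrite ltr_pdivrMr// mulrC.
have t01 : 0 <= t <= 1 by rewrite ltW.
have := epi_convex f_convex (dom_epi f_proper fc) (dom_epi f_proper fx) t01.
move=> /epi_dom; congr dom; rewrite /u; field; exact: lt0r_neq0.
Qed.

Definition subgradient (x y : R) : Prop :=
  forall u, dom f u -> fine (f x) + y * (u - x) <= fine (f u).

Lemma fderiv_subgradient x u : (dom f)° x -> dom f u ->
  fine (f x) + fderiv f x * (u - x) <= fine (f u).
Proof.
move=> xi fu; have [->|ux] := eqVneq u x; first by rewrite subrr mulr0 addr0.
have fx : dom f x by exact: interior_subset xi.
have [_ fdr _] := f_smooth.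
rewrite -lerBrDl; apply: (@derive1_dir_le _ _ _ _ _ 1) => //.
- by rewrite subr_eq0.
- exact: fdr.
- move=> h /andP[h0 h1]; have h01 : 0 <= h <= 1 by rewrite !ltW.
  have := epi_convex f_convex (dom_epi f_proper fu) (dom_epi f_proper fx) h01.
  move=> /(epi_fine f_proper).
  have -> : h * u + (1 - h) * x = x + h * (u - x) by ring.
  by rewrite /comp; lra.
Qed.

Lemma subgradient_fderiv x y : (dom f)° x -> subgradient x y -> y = fderiv f x.
Proof.
move=> xi xy; have [_ fdr _] := f_smooth.
have [e e0 xe] := (interior_domP x).1 xi.
have H v : `|v| = 1 -> y * v <= fderiv f x * v.
  move=> v1; apply: (@derive1_dir_ge _ _ _ _ _ e) => //.
  - by rewrite -normr_eq0 v1 oner_eq0.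
  - exact: fdr.
  - move=> h /andP[h0 he]; have /xy : dom f (x + h * v).
      by apply: xe; rewrite addrAC subrr add0r normrM v1 mulr1 gtr0_norm.
    by rewrite /comp; lra.
have := H 1 (normr1 _); have := H (-1); rewrite normrN normr1 => /(_ erefl).
lra.
Qed.

(* At a boundary point the derivative would blow up along a segment into the
   interior of the domain, while a subgradient there keeps it bounded. *)
Lemma subgradient_interior x y : dom f x -> subgradient x y -> (dom f)° x.
Proof.
move=> fx xy; apply: contrapT => nix.
have [[c ci] _ blow] := f_smooth.
have fc : dom f c by exact: interior_subset ci.
have cx : c - x != 0.
  by rewrite subr_eq0; apply/eqP => cx; apply: nix; rewrite -cx.
pose t k : R := k.+2%:R^-1.
have t0 k : 0 < t k by rewrite invr_gt0.
have t2 k : t k <= 2^-1 by rewrite lef_pV2 ?posrE// ler_nat.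
pose u k := (1 - t k) * x + t k * c.
have ui k : (dom f)° (u k).
  by apply: interior_dom_convex => //; rewrite t0/=; have := t2 k; lra.
have uE k : u k = x + (c - x) * t k by rewrite /u; ring.
have u_cvg : u @ \oo --> x.
  have -> : u = (fun k => x + (c - x) * t k) by apply/funext.
  suff : (fun k => x + (c - x) * t k) @ \oo --> x + (c - x) * 0.
    by rewrite mulr0 addr0.
  apply: cvgD; first exact: cvg_cst.
  apply: cvgMr; rewrite /t.
  by have := @cvg_harmonic R; rewrite -cvg_shiftS.
have /blow/(_ u_cvg) : (closure (dom f) `\` (dom f)°) x.
  by split => //; exact: subset_closure.
pose B := 2 * (`|fine (f c) - fine (f x)| + `|y * (c - x)|).
move=> /(_ ui)/cvgryPgt/(_ (B / `|c - x|)) [k _ /(_ k (leqnn k))]/=.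
rewrite ltr_pdivrMr ?normr_gt0// -normrM; apply/negP; rewrite -leNgt.
have fu : dom f (u k) by exact: interior_subset (ui k).
have := fderiv_subgradient (ui k) fx; have := fderiv_subgradient (ui k) fc.
have := xy _ fu; set D := fderiv f (u k); rewrite uE.
have -> : y * (x + (c - x) * t k - x) = t k * (y * (c - x)) by ring.
have -> : D * (c - (x + (c - x) * t k)) = (1 - t k) * (D * (c - x)) by ring.
have -> : D * (x - (x + (c - x) * t k)) = - (t k * (D * (c - x))) by ring.
set X := D * (c - x); set Y := y * (c - x) => h1 h2 h3.
have tk := t2 k.
have YX : Y <= X.
  by rewrite -(ler_pM2l (t0 k)); lra.
have tY : `|t k * Y| <= `|Y|.
  rewrite normrM (gtr0_norm (t0 k)) ler_piMl//; lra.
have X1 : (1 - t k) * X <= `|fine (f c) - fine (f x)| + `|Y|.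
  have := ler_norm (fine (f c) - fine (f x)).
  have := ler_norm (- (t k * Y)); rewrite normrN; lra.
have X2 : X <= B.
  have [X0|X0] := leP X 0; first by rewrite (le_trans X0)// mulr_ge0// addr_ge0.
  have : 2^-1 * X <= (1 - t k) * X by rewrite ler_pM2r//; lra.
  rewrite /B; lra.
rewrite ler_norml X2 andbT /B -/Y.
have := ler_norm (- Y); rewrite normrN; have := normr_ge0 Y.
have := normr_ge0 (fine (f c) - fine (f x)); lra.
Qed.

End Subgradients.

Section StrongConvexity.
Variables (R : realType) (f : R -> \bar R).
Hypotheses (f_ge0 : forall x : R, (0%:E <= f x)%E) (f_proper : proper_efun f)
  (f_convex : econvex f).
Variable W : set R.
Hypotheses (W_finite : finite_set W)
  (f_strong : forall C : set R, compact C -> convex_set (C : set R^o) ->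
     C `<=` (dom f)° `\` W -> strongly_convex_on f C).
Local Notation E := (epi f).

Lemma strongly_convex_near x : (dom f)° x -> ~ W x ->
  exists d mu : R, [/\ 0 < d, 0 < mu,
    forall u, `|u - x| <= d -> dom f u &
    forall u v a b t, `|u - x| <= d -> `|v - x| <= d -> E u a -> E v b ->
      0 <= t <= 1 -> E (t * u + (1 - t) * v)
        (t * a + (1 - t) * b - mu / 2 * (t * (1 - t)) * (u - v) ^+ 2)].
Proof.
move=> xi nWx.
have /interior_domP[e e0 He] := xi.
have [e' e'0 He'] := nbhs_avoid_finite x W_finite.
pose d := Num.min (e / 2) (e' / 2).
have d0 : 0 < d by rewrite lt_min !divr_gt0.
have de : d < e by apply: le_lt_trans (_ : e / 2 < e); [rewrite ge_min lexx|lra].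
have de' : d < e'.
  by apply: le_lt_trans (_ : e' / 2 < e'); [rewrite ge_min lexx orbT|lra].
pose C : set R := `[x - d, x + d]%classic.
have CP u : C u <-> `|u - x| <= d.
  by rewrite /C/= in_itv/= ler_distl.
have Cseg (u v t : R) : C u -> C v -> 0 <= t <= 1 -> C (t * u + (1 - t) * v).
  move=> /CP + /CP; rewrite !ler_norml => /andP[u1 u2] /andP[v1 v2] /andP[t0 t1].
  apply/CP; rewrite ler_norml.
  have := ler_wpM2l t0 u1; have := ler_wpM2l t0 u2.
  have t1' : 0 <= 1 - t by lra.
  have := ler_wpM2l t1' v1; have := ler_wpM2l t1' v2; lra.
have Cconv : convex_set (C : set R^o).
  move=> u v t; rewrite !inE => Cu Cv.
  by apply: (Cseg _ _ t%:num Cu Cv); apply/andP.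
have Csub : C `<=` (dom f)° `\` W.
  move=> u /CP ud; split.
    apply/interior_domP; exists (e - d) => [|y yu]; first by rewrite subr_gt0.
    apply: He; rewrite -(subrKA u); apply: le_lt_trans (ler_normD _ _) _; lra.
  have [->//|ux] := eqVneq u x.
  by apply: He' => //; exact: le_lt_trans ud de'.
have Ccomp : compact C by exact: segment_compact.
have [mu mu0 Hmu] := f_strong Ccomp Cconv Csub.
exists d, mu; split => // [u ud|u v a b t /CP uC /CP vC ua vb t01].
  by apply: He; exact: le_lt_trans ud de.
have := Hmu u v t uC vC t01; rewrite /epi => /le_trans; apply.
have /andP[t0 t1] := t01.
rewrite [leRHS]EFinB leeB// [leRHS]EFinD (EFinM t) (EFinM (1 - t)).
by rewrite leeD// lee_wpmul2l// lee_fin; lra.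
Qed.

Lemma strongly_convex_growth x a0 y : (dom f)° x -> ~ W x -> E x a0 ->
  (forall u a, E u a -> 0 <= a - a0 - y * (u - x)) ->
  exists c d : R, [/\ 0 < c, 0 < d,
    forall u a, E u a -> `|u - x| <= d -> c * (u - x) ^+ 2 <= a - a0 - y * (u - x) &
    forall u a, E u a -> d <= `|u - x| -> c * `|u - x| <= a - a0 - y * (u - x)].
Proof.
move=> xi nWx xa0 g0.
have [d [mu [d0 mu0 _ Hmu]]] := strongly_convex_near xi nWx.
have gin u a : E u a -> `|u - x| <= d ->
    mu / 4 * (u - x) ^+ 2 <= a - a0 - y * (u - x).
  move=> ua ud; have t01 : 0 <= (2^-1 : R) <= 1 by lra.
  have := Hmu u x a a0 2^-1 ud _ ua xa0 t01; rewrite subrr normr0 => /(_ (ltW d0)).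
  move=> /g0; lra.
have mud : 0 < mu * d by rewrite mulr_gt0.
pose c := Num.min (mu / 4) (mu / 4 * d).
have c0 : 0 < c by rewrite lt_min; apply/andP; split; lra.
exists c, d; split => // u a ua.
  move=> /(gin _ _ ua); apply: le_trans.
  by rewrite ler_wpM2r ?sqr_ge0// ge_min lexx.
move=> du; have ux0 : 0 < `|u - x| by lra.
pose l := d / `|u - x|.
have l0 : 0 < l by rewrite divr_gt0.
have l01 : 0 <= l <= 1 by rewrite (ltW l0) ler_pdivrMr// mul1r.
have lu : l * `|u - x| = d by rewrite /l divfK// lt0r_neq0.
have := gin _ _ (epi_convex f_convex ua xa0 l01).
have -> : l * u + (1 - l) * x - x = l * (u - x) by ring.
have -> : l * a + (1 - l) * a0 - a0 - y * (l * (u - x)) =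
  l * (a - a0 - y * (u - x)) by ring.
rewrite normrM (gtr0_norm l0) lu => /(_ (lexx _)).
rewrite exprMn -[(u - x) ^+ 2]real_normK ?num_real// -exprMn lu expr2.
rewrite -[X in _ * (_ * X)]lu [d * _]mulrCA [_ * (l * _)]mulrCA ler_pM2l// mulrA.
apply: le_trans; rewrite ler_wpM2r//.
by rewrite ge_min lexx orbT.
Qed.

Lemma strongly_convex_slope d y w : (dom f)° !=set0 -> d ^+ 2 = 1 ->
  recession_bound f d (y * d) ->
  (forall u a, E u a -> 0 <= a - y * u + w) ->
  exists c u1 : R, 0 < c /\
    forall u a, E u a -> c * ((u1 - u) * d) <= a - y * u + w.
Proof.
move=> [x0 x0i] d1 dy g0.
have [x [xi nWx]] : exists x, (dom f)° x /\ ~ W x.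
  have [e' e'0 He'] := nbhs_avoid_finite x0 W_finite.
  have /interior_domP[e e0 He] := x0i.
  pose r := Num.min (e / 2) (e' / 2).
  have r0 : 0 < r by rewrite lt_min !divr_gt0.
  have re : r <= e / 2 by rewrite ge_min lexx.
  have re' : r <= e' / 2 by rewrite ge_min lexx orbT.
  have rE : `|x0 + r - x0| = r by rewrite addrAC subrr add0r gtr0_norm.
  exists (x0 + r); split.
    apply/interior_domP; exists (e / 2); first by rewrite divr_gt0.
    move=> u ur; apply: He; rewrite -(subrKA (x0 + r)).
    apply: le_lt_trans (ler_normD _ _) _; rewrite rE; lra.
  by apply: He'; rewrite ?rE; [lra|rewrite -subr_eq0 addrAC subrr add0r lt0r_neq0].
have [dl [mu [dl0 mu0 domf Hmu]]] := strongly_convex_near xi nWx.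
have nd : `|d| = 1.
  by apply/eqP; rewrite -sqr_norm_eq1 d1.
pose F u := fine (f u).
pose v1 := x - dl * d; pose v2 := x + dl * d.
have n1 : `|v1 - x| <= dl.
  by rewrite /v1 addrAC subrr sub0r normrN normrM nd mulr1 gtr0_norm.
have n2 : `|v2 - x| <= dl.
  by rewrite /v2 addrAC subrr add0r normrM nd mulr1 gtr0_norm.
have E1 : E v1 (F v1) by exact/(dom_epi f_proper)/domf.
have E2 : E v2 (F v2) by exact/(dom_epi f_proper)/domf.
have Ex : E x (F x) by apply: (dom_epi f_proper); exact: interior_subset xi.
have t01 : 0 <= (2^-1 : R) <= 1 by lra.
have := epi_fine f_proper (Hmu _ _ _ _ _ n1 n2 E1 E2 t01).
have -> : 2^-1 * v1 + (1 - 2^-1) * v2 = x by rewrite /v1 /v2; field.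
have -> : (v1 - v2) ^+ 2 = 4 * dl ^+ 2 * d ^+ 2 by rewrite /v1 /v2; ring.
rewrite d1 -/(F x) => h1.
have := epi_fine f_proper (dy _ _ _ (ltW dl0) Ex); rewrite -/v2 -/(F v2) => h2.
exists (mu * dl), v1; split; first by rewrite mulr_gt0.
move=> u a ua; set s := (v1 - u) * d.
have mudl : 0 < mu * dl by rewrite mulr_gt0.
have [s0|s0] := leP s 0.
  by apply: le_trans (g0 _ _ ua); rewrite pmulr_rle0.
have sdl : 0 < s + dl by lra.
pose l := dl / (s + dl).
have l0 : 0 < l by rewrite divr_gt0.
have l01 : 0 <= l <= 1 by rewrite (ltW l0) ler_pdivrMr// mul1r; lra.
have uE : u = v1 - s * d.
  by rewrite /s -mulrA -expr2 d1 mulr1 opprB addrC subrK.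
have := epi_fine f_proper (epi_convex f_convex ua Ex l01).
have -> : l * u + (1 - l) * x = v1.
  rewrite uE /l /v1; field; exact: lt0r_neq0.
rewrite -/(F v1) => h3; have hx := g0 _ _ Ex.
have h4 : mu * dl ^+ 2 <= l * (a - y * u + w).
  have : l * (y * u) = y * (v1 - (1 - l) * x).
    by rewrite uE /l /v1; field; exact: lt0r_neq0.
  have : 0 <= l * (F x - y * x + w) by rewrite mulr_ge0// ltW.
  rewrite /v1; lra.
have : mu * dl * (s + dl) <= a - y * u + w.
  rewrite -ler_pdivlMr// -(ler_pM2l dl0).
  have -> : dl * (mu * dl) = mu * dl ^+ 2 by ring.
  by apply: le_trans h4 _; rewrite /l mulrAC -mulrA.
have : mu * dl * (s + dl) = mu * dl * s + mu * dl ^+ 2 by ring.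
have : 0 <= mu * dl ^+ 2 by rewrite mulr_ge0 ?sqr_ge0 ?ltW.
lra.
Qed.

End StrongConvexity.

(** * Exceptional normals *)

Lemma affine_coercive (R : realType) (D : set R) (z1 z2 a : R) :
  z1 != 0 -> (forall u, D u -> 0 <= z1 * (u - a)) -> 0 < z1 * a + z2 ->
  exists2 c : R, 0 < c & forall u, D u -> c * (1 + `|u|) <= z1 * u + z2.
Proof.
move=> z10 Da c0; have a1 : 0 < 1 + `|a| by have := normr_ge0 a; lra.
pose c := Num.min `|z1| ((z1 * a + z2) / (1 + `|a|)).
have cpos : 0 < c by rewrite lt_min normr_gt0 z10 divr_gt0.
exists c => // u Du.
have c1 : c * `|u - a| <= z1 * (u - a).
  by rewrite -[leRHS]ger0_norm ?Da// normrM ler_wpM2r// ge_min lexx.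
have c2 : c * (1 + `|a|) <= z1 * a + z2.
  by rewrite -ler_pdivlMr// ge_min lexx orbT.
have : c * `|u| <= c * (`|u - a| + `|a|).
  by rewrite ler_pM2l// -{1}(subrK a u) ler_normD.
lra.
Qed.

Lemma affine_coercive_bounds (R : realType) (D : set R) (z1 z2 : R) :
  D !=set0 -> z1 != 0 -> (forall u, D u -> 0 <= z1 * u + z2) ->
  (0 < z1 -> z2 <> - z1 * inf D) -> (z1 < 0 -> z2 <> - z1 * sup D) ->
  exists2 c : R, 0 < c & forall u, D u -> c * (1 + `|u|) <= z1 * u + z2.
Proof.
move=> D0 z10 Dz infD supD.
have [z1n|z1p|/eqP] := ltgtP z1 0; last by rewrite (negPf z10).
  have ub : ubound D (z2 / - z1).
    by move=> u /Dz h; rewrite ler_pdivlMr ?oppr_gt0//; lra.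
  apply: (@affine_coercive _ _ _ _ (sup D)) => //.
    move=> u Du; rewrite -mulrNN mulr_ge0 ?oppr_ge0 ?(ltW z1n)// subr_le0.
    by apply: ub_le_sup => //; exists (z2 / - z1).
  have : sup D <= z2 / - z1 by exact: ge_sup.
  rewrite ler_pdivlMr ?oppr_gt0// => h.
  rewrite lt_neqAle; apply/andP; split; last by lra.
  by apply/eqP => h0; apply: (supD z1n); lra.
have lb : lbound D (- z2 / z1).
  by move=> u /Dz h; rewrite ler_pdivrMr//; lra.
apply: (@affine_coercive _ _ _ _ (inf D)) => //.
  move=> u Du; rewrite mulr_ge0 ?(ltW z1p)// subr_ge0.
  by apply: ge_inf => //; exists (- z2 / z1).
have : - z2 / z1 <= inf D by exact: lb_le_inf.
rewrite ler_pdivrMr// => h.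
rewrite lt_neqAle; apply/andP; split; last by lra.
by apply/eqP => h0; apply: (infD z1p); lra.
Qed.

Section ExceptionalNormals.
Variables (R : realType) (f : R -> \bar R).
Hypotheses (f_ge0 : forall x : R, (0%:E <= f x)%E) (f_proper : proper_efun f)
  (f_closed : lower_semicontinuous f) (f_convex : econvex f)
  (f_smooth : essentially_smooth f).
Variable W : seq R.
Hypothesis f_strong : forall C : set R, compact C -> convex_set (C : set R^o) ->
  C `<=` (dom f)° `\` [set` W] -> strongly_convex_on f C.
Local Notation E := (epi f).
Local Notation K := (epi_perspective f).

Lemma vec3Z (c x t r : R) : c *: vec3 x t r = vec3 (c * x) (c * t) (c * r).
Proof. by apply/rowP; apply: ord3P; rewrite !mxE. Qed.

(* The slope of the supporting hyperplane containing the extreme recession ray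
   in the direction [d = 1] or [d = -1], and the value there of the conjugate
   of [f]. *)
Definition recession_slope (d : R) : R := d * inf [set r | recession_bound f d r].

Definition recession_conj (d : R) : R :=
  sup [set recession_slope d * p.1 - p.2 | p in [set p : R * R | E p.1 p.2]].

Definition exceptional_normals : seq 'rV[R]_3 :=
  [:: vec3 0 1 0, vec3 1 (- inf (dom f)) 0, vec3 (-1) (sup (dom f)) 0,
      vec3 (- recession_slope 1) (recession_conj 1) 1,
      vec3 (- recession_slope (-1)) (recession_conj (-1)) 1 &
      [seq vec3 (- fderiv f x) (fderiv f x * x - fine (f x)) 1 | x <- W]].

Lemma holder_half_vertical_normal (z1 z2 : R) :
  (forall u, dom f u -> 0 <= z1 * u + z2) ->
  ~ rays exceptional_normals (vec3 z1 z2 0) ->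
  uniform_holder_error_bound K (orthv (vec3 z1 z2 0)) (1 / 2).
Proof.
move=> zD nz; have D0 : dom f !=set0 by case: f_proper.
have nray d c : d \in exceptional_normals -> 0 <= c -> vec3 z1 z2 0 <> c *: d.
  by move=> dE c0 zE; apply: nz; exists d => //; exists c.
have [z10|z10] := eqVneq z1 0.
  exfalso; apply: (nray (vec3 0 1 0) z2); rewrite ?inE ?eqxx//.
    by case: D0 => u /zD; rewrite z10 mul0r add0r.
  by rewrite vec3Z z10 mulr0 mulr1.
have infD : 0 < z1 -> z2 <> - z1 * inf (dom f).
  move=> z1p zE; apply: (nray (vec3 1 (- inf (dom f)) 0) z1).
  - by rewrite !inE eqxx !orbT.
  - exact: ltW.
  - by rewrite vec3Z zE; congr vec3; ring.
have supD : z1 < 0 -> z2 <> - z1 * sup (dom f).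
  move=> z1n zE; apply: (nray (vec3 (-1) (sup (dom f)) 0) (- z1)).
  - by rewrite !inE eqxx !orbT.
  - by rewrite oppr_ge0 ltW.
  - by rewrite vec3Z zE mulrNN mulr1 mulr0.
have [c c0 cD] := affine_coercive_bounds D0 z10 zD infD supD.
by apply: holder_half_vertical c0 cD.
Qed.

Lemma holder_half_slope_normal (y w : R) (p : 'rV[R]_3) :
  (forall q, K q -> 0 <= dotv (vec3 (- y) w 1) q) ->
  K p -> p <> 0 -> dotv (vec3 (- y) w 1) p = 0 ->
  ~ rays exceptional_normals (vec3 (- y) w 1) ->
  uniform_holder_error_bound K (orthv (vec3 (- y) w 1)) (1 / 2).
Proof.
move=> zK Kp pn0 zp nz.
have dotE q : dotv (vec3 (- y) w 1) q = q 0 2 - y * q 0 0 + w * q 0 1.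
  by rewrite dotv3 !vec3E; ring.
have nray d : d \in exceptional_normals -> vec3 (- y) w 1 <> d.
  by move=> dE zE; apply: nz; exists d => //; exists 1 => //; rewrite scale1r.
have g0 u a : E u a -> 0 <= a - y * u + w.
  move=> /(epi_perspective_lift f_proper f_closed f_convex ler01)/zK.
  by rewrite dotE !vec3E !mul1r mulr1.
have Di : (dom f)° !=set0 by case: f_smooth.
move: Kp => /(epi_perspectiveP f_proper f_closed f_convex)[[t0 pE]|[tE prec]].
  have t1 := lt0r_neq0 t0.
  set x := p 0 0 / p 0 1 in pE *; set a0 := p 0 2 / p 0 1 in pE *.
  have wE : w = y * x - a0.
    rewrite dotE in zp; rewrite /x /a0; apply: (mulIf t1).
    by rewrite mulrBl mulrA !divfK//; lra.
  have gx u a : E u a -> 0 <= a - a0 - y * (u - x).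
    by move=> /g0; rewrite wE; lra.
  have fx : dom f x by exact: epi_dom pE.
  have a0E : fine (f x) = a0.
    have := gx _ _ (dom_epi f_proper fx); have := epi_fine f_proper pE.
    by rewrite subrr mulr0; lra.
  have sx : subgradient f x y.
    by move=> u /(dom_epi f_proper)/gx; rewrite a0E; lra.
  have xi := subgradient_interior f_proper f_convex f_smooth fx sx.
  have yE := subgradient_fderiv f_smooth xi sx.
  have nWx : ~ [set` W] x.
    move=> /= xW; apply: (nray (vec3 (- fderiv f x) (fderiv f x * x - fine (f x)) 1)).
      by do 5 (rewrite inE; apply/orP; right); apply/mapP; exists x.
    by rewrite -yE a0E wE.
  have [c [d [c0 d0 gin gout]]] :=
    strongly_convex_growth f_convex (finite_seq W) f_strong xi nWx pE gx.
  by rewrite wE; exact: holder_half_strongly_convex gin gout.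
have rE : p 0 2 = y * p 0 0 by rewrite dotE tE in zp; lra.
have X0 : p 0 0 != 0.
  apply/eqP => pX; apply: pn0; rewrite [p]vec3_eta rE pX tE mulr0.
  by apply/rowP; apply: ord3P; rewrite !mxE.
pose d := Num.sg (p 0 0).
have d1 : d ^+ 2 = 1 by rewrite sqr_sg X0.
have dE : d = `|p 0 0|^-1 * p 0 0.
  by rewrite /d {3}[p 0 0]numEsg mulrCA mulVf ?normr_eq0// mulr1.
have drec : recession_bound f d (y * d).
  by rewrite dE mulrCA -rE; exact: recession_bound_scale.
have dmin r : recession_bound f d r -> y * d <= r.
  move=> /(epi_perspective_recession f_proper f_closed f_convex)/zK.
  by rewrite dotE !vec3E; lra.
have slopeE : recession_slope d = y.
  rewrite /recession_slope; have -> : inf [set r | recession_bound f d r] = y * d.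
    apply/eqP; rewrite eq_le; apply/andP; split.
      by apply: ge_inf => //; exists (y * d).
    by apply: lb_le_inf; first by exists (y * d).
  by rewrite mulrCA -expr2 d1 mulr1.
have S0 : [set recession_slope d * q.1 - q.2 | q in [set q : R * R | E q.1 q.2]] !=set0.
  have [_ [u fu]] := f_proper.
  by exists (recession_slope d * u - fine (f u)), (u, fine (f u)) => //=; exact: dom_epi.
have Sw : ubound [set recession_slope d * q.1 - q.2 | q in [set q : R * R | E q.1 q.2]] w.
  by move=> _ [[u a] /= ua <-]; rewrite slopeE; have := g0 _ _ ua; lra.
have wS : w <> recession_conj d.
  move=> wE; apply: (nray (vec3 (- recession_slope d) (recession_conj d) 1)); last first.
    by rewrite slopeE -wE.
  have : (d == 1) || (d == -1) by rewrite -sqrf_eq1 d1.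
  by move=> /orP[] /eqP ->; rewrite !inE eqxx !orbT.
have dl0 : 0 < w - recession_conj d.
  rewrite subr_gt0 lt_neqAle; apply/andP; split; first by apply/eqP => /esym.
  exact: ge_sup.
have [c [u1 [c0 gc]]] :=
  strongly_convex_slope f_proper f_convex (finite_seq W) f_strong Di d1 drec g0.
apply: holder_half_recession d1 drec dl0 c0 _ gc => // u a ua.
have : y * u - a <= recession_conj d.
  by apply: ub_le_sup; [exists w|exists (u, a) => //=; rewrite slopeE].
lra.
Qed.

Lemma holder_half_dual_normal (z p : 'rV[R]_3) :
  (forall q, K q -> 0 <= dotv z q) -> K p -> p <> 0 -> dotv z p = 0 ->
  ~ rays exceptional_normals z ->
  uniform_holder_error_bound K (orthv z) (1 / 2).
Proof.
move=> zK Kp p0 zp nz.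
have z20 : 0 <= z 0 2.
  have /zK : K (vec3 0 0 1).
    exact/(epi_perspective_recession f_proper f_closed f_convex)/recession_bound0.
  by rewrite dotv3 !vec3E; lra.
have gz u a : E u a -> 0 <= z 0 0 * u + z 0 1 + z 0 2 * a.
  move=> /(epi_perspective_lift f_proper f_closed f_convex ler01)/zK.
  by rewrite dotv3 !vec3E !mul1r mulr1.
have [z2|z2] := eqVneq (z 0 2) 0.
  rewrite [z]vec3_eta z2; apply: holder_half_vertical_normal.
    by move=> u /(dom_epi f_proper)/gz; rewrite z2 mul0r addr0.
  by rewrite -z2 -vec3_eta.
have z2p : 0 < z 0 2 by rewrite lt_neqAle eq_sym z2.
pose y := - z 0 0 / z 0 2; pose w := z 0 1 / z 0 2.
have zE : z = z 0 2 *: vec3 (- y) w 1.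
  rewrite {1}[z]vec3_eta vec3Z /y /w; congr vec3; field => //.
have dotE q : dotv (vec3 (- y) w 1) q = dotv z q / z 0 2.
  by rewrite !dotv3 !vec3E /y /w; field.
rewrite zE orthvZ//; apply: (@holder_half_slope_normal y w p) => //.
- by move=> q /zK zq; rewrite dotE divr_ge0.
- by rewrite dotE zp mul0r.
- move=> [d dE [c c0 dc]]; apply: nz; exists d => //.
  by exists (z 0 2 * c); [rewrite mulr_ge0|rewrite {1}zE dc scalerA].
Qed.

End ExceptionalNormals.

Theorem corollary5p7 (R : realType) (f : R -> \bar R)
    (f_ge0 : forall x : R, (0%:E <= f x)%E)
    (f_proper : proper_efun f)
    (f_closed : lower_semicontinuous f)
    (f_convex : econvex f)
    (f_smooth : essentially_smooth f)
    (W : set R) (W_finite : finite_set W) (W_dom : W `<=` (dom f)°)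
    (f_strong : forall C : set R, compact C -> convex_set (C : set R^o) ->
       C `<=` (dom f)° `\` W -> strongly_convex_on f C)
    (f_lip : forall C : set R, convex_set (C : set R^o) ->
       C `<=` (dom f)° `\` W -> [locally [lipschitz (fderiv f x) | x in C]])
    (s : R) (s_gt1 : 1 < s) :
  let K := epi_perspective f in
  let Upsilon := [set z : 'rV[R]_3 | nontrivially_weakly_feasible (orthv z) K] in
  hausdorff_ae_in s Upsilon
    (fun z => uniform_holder_error_bound K (orthv z) (1 / 2)).
Proof.
move=> K Upsilon.
have [Ws WE] := (finite_seqP _).1 W_finite; rewrite {W_finite f_lip W_dom}WE in f_strong.
pose v := exceptional_normals f Ws.
exists (rays (v ++ map -%R v)); first exact: hausdorff_measure_rays.
move=> z zU nz; have [Di _ _] := f_smooth.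
have [[e e0 zK] [p Kp [p0 zp]]] :=
  weakly_feasible_dual f_ge0 f_proper f_closed f_convex Di zU.
rewrite -(orthvZ z e0); apply: (@holder_half_dual_normal _ f _ _ _ _ _ Ws _ _ p) => //.
  by rewrite dotZv zp mulr0.
move=> [d dv [c c0 zE]]; apply: nz.
have zE' : z = (c / e) *: d by rewrite mulrC -scalerA -zE scalerA mulVf// scale1r.
have [ep|en] := ltP 0 e.
  by exists d; [rewrite mem_cat dv|exists (c / e) => //; rewrite divr_ge0// ltW].
exists (- d); first by rewrite mem_cat map_f ?orbT.
exists (c / - e); first by rewrite divr_ge0// oppr_ge0.
by rewrite invrN mulrN scaleNr scalerN opprK.
Qed.
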